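(* Let $\mathbf{X}^*$ be an $n_1\times n_2$ real matrix, and let $\mathcal{X}$ be a countable collection of candidate reconstructions $\mathbf{X}$ of $\mathbf{X}^*$ (real $n_1\times n_2$ matrices), each with a corresponding penalty $\mathrm{pen}(\mathbf{X})\ge1$, such that $\sum_{\mathbf{X}\in\mathcal{X}}2^{-\mathrm{pen}(\mathbf{X})}\le1$. Fix an integer $m$ with $4\le m\le n_1n_2$, let $\gamma=m(n_1n_2)^{-1}$, generate $\mathcal{S}\subseteq[n_1]\times[n_2]$ by including each $(i,j)$ independently with probability $\gamma$, and obtain observations $\mathbf{Y}_{\mathcal{S}}\sim p_{\mathbf{X}^*_{\mathcal{S}}}=\prod_{(i,j)\in\mathcal{S}}p_{X^*_{i,j}}$, conditionally independent given $\mathcal{S}$. Then, if $C_{\mathrm D}$ is any constant satisfying $$C_{\mathrm D}\ge\max_{\mathbf{X}\in\mathcal{X}}\ \max_{(i,j)\in[n_1]\times[n_2]}\mathrm{D}(p_{X^*_{i,j}}\|p_{X_{i,j}}),$$ we have that for any $$\xi\ge\left(1+\frac{2C_{\mathrm D}}{3}\right)\cdot2\log2,$$ the complexity penalized maximum likelihood estimator $$\widehat{\mathbf{X}}^{\xi}=\widehat{\mathbf{X}}^{\xi}(\mathcal{S},\mathbf{Y}_{\mathcal{S}})=\arg\min_{\mathbf{X}\in\mathcal{X}}\left\{-\log p_{\mathbf{X}_{\mathcal{S}}}(\mathbf{Y}_{\mathcal{S}})+\xi\cdot\mathrm{pen}(\mathbf{X})\right\}$$ satisfies $$\frac{\mathbb{E}_{\mathcal{S},\mathbf{Y}_{\mathcal{S}}}\left[-2\log\mathrm{A}(p_{\widehat{\mathbf{X}}^{\xi}},p_{\mathbf{X}^*})\right]}{n_1n_2}\le3\cdot\min_{\mathbf{X}\in\mathcal{X}}\left\{\frac{\mathrm{D}(p_{\mathbf{X}^*}\|p_{\mathbf{X}})}{n_1n_2}+\left(\xi+\frac{4C_{\mathrm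 D}\log2}{3}\right)\frac{\mathrm{pen}(\mathbf{X})}{m}\right\}+\frac{8C_{\mathrm D}\log m}{m},$$ where the expectation is with respect to the joint distribution of $\mathcal{S}$ and $\mathbf{Y}_{\mathcal{S}}$.
   Context: Notation: $[n]=\{1,\dots,n\}$; $\log$ is the natural logarithm. $\{p_x\}$ is a given family of probability densities (or probability mass functions) of a real-valued random variable, parameterized by a real number $x$. For a matrix $\mathbf{X}$, $p_{\mathbf{X}_{\mathcal{S}}}(\mathbf{Y}_{\mathcal{S}})=\prod_{(i,j)\in\mathcal{S}}p_{X_{i,j}}(Y_{i,j})$. The KL divergence is $\mathrm{D}(p\|q)=\mathbb{E}_p[\log(p(Y)/q(Y))]$ and the Hellinger affinity is $\mathrm{A}(p,q)=\mathbb{E}_p[\sqrt{q(Y)/p(Y)}]$. For matrices, $\mathrm{D}(p_{\mathbf{X}}\|p_{\widetilde{\mathbf{X}}})=\sum_{i,j}\mathrm{D}(p_{X_{i,j}}\|p_{\widetilde X_{i,j}})$ and $\mathrm{A}(p_{\mathbf{X}},p_{\widetilde{\mathbf{X}}})=\prod_{i,j}\mathrm{A}(p_{X_{i,j}},p_{\widetilde X_{i,j}})$, over all $(i,j)\in[n_1]\times[n_2]$. *)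

(* Defs.v *)
From HB Require Import structures.
From mathcomp Require Import all_boot all_order all_algebra.
From mathcomp Require Import all_classical all_reals all_analysis.
From mathcomp Require Import measurable_realfun.

Set Implicit Arguments.
Unset Strict Implicit.
Unset Printing Implicit Defensive.
Import Order.TTheory GRing.Theory Num.Theory.
Import numFieldNormedType.Exports.

Local Open Scope classical_set_scope.
Local Open Scope ring_scope.

Section Divergences.
Context {R : realType}.
(* The dominating measure is arbitrary: Lebesgue measure gives probability
   densities, the counting measure gives probability mass functions. *)
Variable mu : {measure set (measurableTypeR R) -> \bar R}.

Definition is_density (f : R -> R) : Prop :=
  [/\ measurable_fun [set: measurableTypeR R] (f : measurableTypeR R -> R),
      forall y, 0 <= f y
    & (\int[mu]_y (f y)%:E = 1)%E].

(* E_f[g(Y)] for Y with density f; since 0 * +oo = 0, the values of g outside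
   the support of f are irrelevant. *)
Definition dens_expectation (f : R -> R) (g : R -> \bar R) : \bar R :=
  (\int[mu]_y ((f y)%:E * g y))%E.

(* The quotient is taken in \bar R, where r / 0 = +oo for r > 0, so that the
   integrand is +oo where f is positive and g vanishes. *)
Definition KL (f g : R -> R) : \bar R :=
  dens_expectation f (fun y => lne ((f y)%:E / (g y)%:E))%E.

Definition affinity (f g : R -> R) : \bar R :=
  dens_expectation f (fun y => (Num.sqrt (g y / f y))%:E).

Variables (p : R -> R -> R) (n1 n2 : nat).
Implicit Types X Z : 'M[R]_(n1, n2).

Definition KL_mx X Z : \bar R :=
  (\sum_(i < n1) \sum_(j < n2) KL (p (X i j)) (p (Z i j)))%E.

Definition affinity_mx X Z : \bar R :=
  (\prod_(i < n1) \prod_(j < n2) affinity (p (X i j)) (p (Z i j)))%E.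

End Divergences.

Section Sampling.
Context {R : realType} {n1 n2 : nat} {d : measure_display}
  {T : measurableType d}.
Variable P : probability T R.

Definition bernoulli_sampling (gamma : R) (S : T -> {set 'I_n1 * 'I_n2}) :
    Prop :=
  forall s : {set 'I_n1 * 'I_n2},
    measurable [set w | S w = s] /\
    P [set w | S w = s] =
      (\prod_(ij : 'I_n1 * 'I_n2)
         (if ij \in s then gamma else 1 - gamma))%:E.

(* Only the entries of Y w indexed by S w are observations; the law of the
   other entries is unconstrained. The conditional law of Y_S given S is
   expressed on measurable rectangles. *)
Definition observation_law (mu : {measure set (measurableTypeR R) -> \bar R})
    (p : R -> R -> R) (Xstar : 'M[R]_(n1, n2))
    (S : T -> {set 'I_n1 * 'I_n2}) (Y : T -> 'M[R]_(n1, n2)) : Prop :=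
  (forall i j,
     measurable_fun [set: T] (fun w => Y w i j : measurableTypeR R)) /\
  forall (s : {set 'I_n1 * 'I_n2})
         (B : 'I_n1 * 'I_n2 -> set (measurableTypeR R)),
    (forall ij, measurable (B ij)) ->
    (P [set w | S w = s /\ forall ij, ij \in s -> B ij (Y w ij.1 ij.2)] =
     P [set w | S w = s] *
     \prod_(ij in s) \int[mu]_(y in B ij) (p (Xstar ij.1 ij.2) y)%:E)%E.

End Sampling.

Section Estimator.
Context {R : realType} {n1 n2 : nat}.

(* (s, observed s y) encodes the data (s, y_s): unobserved entries are
   replaced by 0. *)
Definition observed (s : {set 'I_n1 * 'I_n2}) (y : 'M[R]_(n1, n2)) :
    'M[R]_(n1, n2) :=
  \matrix_(i, j) if (i, j) \in s then y i j else 0.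

Definition likelihood (p : R -> R -> R) (X : 'M[R]_(n1, n2))
    (s : {set 'I_n1 * 'I_n2}) (y : 'M[R]_(n1, n2)) : R :=
  \prod_(ij in s) p (X ij.1 ij.2) (y ij.1 ij.2).

Definition penalized_nll (p : R -> R -> R) (pen : 'M[R]_(n1, n2) -> R)
    (xi : R) (s : {set 'I_n1 * 'I_n2}) (y X : 'M[R]_(n1, n2)) : \bar R :=
  (- lne (likelihood p X s y)%:E + (xi * pen X)%:E)%E.

Definition is_argmin {U : Type} (D : set U) (f : U -> \bar R) (x : U) : Prop :=
  D x /\ forall x', D x' -> (f x <= f x')%E.

(* Any measurable selection of a minimizer is allowed, so ties may be broken
   arbitrarily, and minimality is only required almost surely. As calX is
   meant to be countable, measurability is stated on points. *)
Definition is_penalized_mle {d : measure_display} {T : measurableType d}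
    (P : probability T R) (p : R -> R -> R) (calX : set 'M[R]_(n1, n2))
    (pen : 'M[R]_(n1, n2) -> R) (xi : R)
    (S : T -> {set 'I_n1 * 'I_n2}) (Y : T -> 'M[R]_(n1, n2))
    (Xhat : {set 'I_n1 * 'I_n2} -> 'M[R]_(n1, n2) -> 'M[R]_(n1, n2)) : Prop :=
  [/\ forall w, calX (Xhat (S w) (observed (S w) (Y w))),
      forall X, calX X ->
        measurable [set w | Xhat (S w) (observed (S w) (Y w)) = X]
    & {ae P, forall w,
        is_argmin calX
          (penalized_nll p pen xi (S w) (observed (S w) (Y w)))
          (Xhat (S w) (observed (S w) (Y w)))}].

End Estimator.

(* Main.v *)
Require Import Defs.
From HB Require Import structures.
From mathcomp Require Import all_boot all_order all_algebra.
From mathcomp Require Import all_classical all_reals all_analysis.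
From mathcomp Require Import measurable_realfun.
From mathcomp Require Import ring lra.

(* No concentration inequality is needed: the whole expectation is controlled
   by a single exponential moment, jointly over S and Y. Put
   t = 1 / (2 (1 + 2 CD / 3)), a_X(i,j) = -2 log A(p_(X i j), p_(Xstar i j)),
   and let L_X be the likelihood of X on the sampled entries. At each entry,
   tangent bounds give E (p_X / p_Xstar)^t <= exp (- t a_X) <= 1 - t a_X / 2
   under p_Xstar, as 0 <= a_X <= CD. Hence
     W_X = 2^(- pen X) (L_X / L_Xstar)^t exp (gamma t / 2 * sum a_X)
   satisfies E W_X <= 2^(- pen X), and E (sum_X W_X) <= 1 by Kraft's inequality.
   Taking log w <= w - 1 at w = W_Xhat and comparing the penalized likelihood
   of Xhat with that of a fixed X, where t xi >= log 2, yields almost surely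
     gamma t / 2 * sum a_Xhat
       <= sum_Z W_Z - 1 + t (xi pen X + log (L_Xstar / L_X)).
   Its expectation is the claim, with 2 in place of 3 and no residual term. *)

Set Implicit Arguments.
Unset Strict Implicit.
Unset Printing Implicit Defensive.
Import Order.TTheory GRing.Theory Num.Theory.
Import numFieldNormedType.Exports.

Local Open Scope classical_set_scope.
Local Open Scope ring_scope.

(** * Integrals of products of functions of independent observations *)

Import HBNNSimple.

(** Monotone convergence along simple functions increasing to [g]. The right side sees the measure
    and the weight only through integrals against indicators, so two weighted integrals can be
    compared term by term. *)
Lemma weighted_integral_nnsfun_approx d (T : measurableType d) (R : realType)
    (P : {measure set T -> \bar R}) dV (V : measurableType dV)
    (G : T -> R) (Z : T -> V) (g : V -> R)
    (mg : measurable_fun [set: V] (EFin \o g)) :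
  measurable_fun [set: T] G -> (forall w, 0 <= G w) ->
  measurable_fun [set: T] Z -> (forall v, 0 <= g v) ->
  (\int[P]_w (G w * g (Z w))%:E =
   limn (fun n => \sum_(y \in range (nnsfun_approx measurableT mg n))
     y%:E * \int[P]_w (G w *
       \1_(nnsfun_approx measurableT mg n @^-1` [set y]) (Z w))%:E))%E.
Proof.
move=> mG G0 mZ g0.
set h := nnsfun_approx _ mg.
have mind n y : measurable_fun [set: T] (fun w => \1_(h n @^-1` [set y]) (Z w) : R).
  by apply: measurableT_comp mZ; exact: measurable_indic.
have mhZ n : measurable_fun [set: T] (fun w => h n (Z w)).
  by apply: measurableT_comp mZ; exact: measurable_funP.
transitivity (\int[P]_w limn (fun n => ((G w * h n (Z w))%:E)))%E.
  apply: eq_integral => w _; apply/esym/cvg_lim => //.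
  have gE0 v : [set: V] v -> (0 <= (EFin \o g) v)%E by rewrite /= lee_fin.
  have := cvg_nnsfun_approx measurableT mg gE0 (x := Z w) I.
  by move/(cvgeZl (y := (G w)%:E) isT).
rewrite monotone_convergence//; last 3 first.
- by move=> n; apply/measurable_EFinP; exact: measurable_funM.
- by move=> n w _; rewrite lee_fin mulr_ge0.
- by move=> w _ a b ab; rewrite lee_fin ler_wpM2l//; exact/lefP/nd_nnsfun_approx.
congr (limn _); apply/funext => n.
transitivity (\int[P]_w (\sum_(y \in range (h n))
    (y * (G w * \1_(h n @^-1` [set y]) (Z w)))%:E))%E.
  apply: eq_integral => w _.
  rewrite (fimfunE (h n)) fsumEFin//; congr EFin.
  rewrite mulr_fsumr//; apply: eq_fsbigr => y _; ring.
rewrite ge0_integral_fsum//; last 2 first.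
- by move=> y; apply/measurable_EFinP; do 2! apply: measurable_funM => //.
- move=> y w _; rewrite lee_fin mulrCA mulr_ge0//.
  have [->|yne] := eqVneq (\1_(h n @^-1` [set y]) (Z w)) (0:R); first by rewrite mulr0.
  rewrite mulr_ge0// ?ler0n//.
  move: yne; rewrite indicE; case: (boolP (_ \in _)); last by rewrite eqxx.
  by rewrite inE /= => <- _; exact: fun_ge0.
apply: eq_fsbigr => y yh.
under eq_integral do rewrite EFinM.
rewrite ge0_integralZl//; last 3 first.
- by apply/measurable_EFinP; exact: measurable_funM.
- by move=> w _; rewrite lee_fin mulr_ge0.
- by move: yh; rewrite inE lee_fin => -[v _ <-]; exact: fun_ge0.
Qed.

(** Agreement on indicators passes to simple functions, then to [g], since both sides are limits of
    the same sums. *)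
Lemma eq_weighted_integral d (T : measurableType d) dU (U : measurableType dU)
    dV (V : measurableType dV) (R : realType)
    (P : {measure set T -> \bar R}) (mu : {measure set U -> \bar R})
    (G : T -> R) (Z : T -> V) (H : U -> R) (W : U -> V) (g : V -> R) :
  measurable_fun [set: T] G -> (forall w, 0 <= G w) ->
  measurable_fun [set: T] Z ->
  measurable_fun [set: U] H -> (forall u, 0 <= H u) ->
  measurable_fun [set: U] W ->
  (forall B, measurable B ->
    \int[P]_w (G w * \1_B (Z w))%:E = \int[mu]_u (H u * \1_B (W u))%:E)%E ->
  measurable_fun [set: V] g -> (forall v, 0 <= g v) ->
  (\int[P]_w (G w * g (Z w))%:E = \int[mu]_u (H u * g (W u))%:E)%E.
Proof.
move=> mG G0 mZ mH H0 mW GH mg g0.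
have mgE : measurable_fun [set: V] (EFin \o g) by exact/measurable_EFinP.
rewrite (weighted_integral_nnsfun_approx P mgE)//.
rewrite (weighted_integral_nnsfun_approx mu mgE)//.
congr (limn _); apply/funext => n; apply: eq_fsbigr => y _.
by rewrite GH.
Qed.

Lemma density_integral_set (R : realType)
    (mu : {measure set (measurableTypeR R) -> \bar R}) (h : R -> R) B :
  is_density mu h -> measurable B ->
  (\int[mu]_y (h y * \1_B y)%:E = \int[mu]_(y in B) (h y)%:E)%E /\
  (\int[mu]_(y in B) (h y)%:E)%E \is a fin_num.
Proof.
move=> [mh h0 h1] mB; split.
  rewrite [RHS]integral_mkcond; apply: eq_integral => y _.
  by rewrite patchE indicE; case: ifPn => _; rewrite ?mulr1 ?mulr0.
rewrite ge0_fin_numE; last by apply: integral_ge0 => y _; rewrite lee_fin.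
apply: (@le_lt_trans _ _ (1%:E : \bar R)); last exact: ltry.
rewrite -h1; apply: ge0_subset_integral => //.
- exact/measurable_EFinP.
- by move=> y _; rewrite lee_fin.
Qed.

(** Independence is given on rectangles, that is, for indicators [f i]. General factors are
    introduced one index at a time: as functions of a single [f k], both sides are integrals of
    [f k] against a measure, so agreement on indicators extends by [eq_weighted_integral]. *)
Lemma integral_prod_rectangles d (T : measurableType d) (R : realType)
    (P : {measure set T -> \bar R})
    (mu : {measure set (measurableTypeR R) -> \bar R})
    (I : finType) (A : {set I}) (E : set T) (e : R)
    (Z : I -> T -> measurableTypeR R) (h : I -> R -> R) :
  measurable E -> 0 <= e ->
  (forall i, measurable_fun [set: T] (Z i)) ->
  (forall i, is_density mu (h i)) ->
  (forall B : I -> set (measurableTypeR R), (forall i, measurable (B i)) ->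
     P (E `&` [set w | forall i, i \in A -> B i (Z i w)]) =
     e%:E * \prod_(i in A) \int[mu]_(y in B i) (h i y)%:E)%E ->
  forall (f : I -> measurableTypeR R -> R) (c : I -> R),
  (forall i, measurable_fun [set: measurableTypeR R] (f i)) ->
  (forall i y, 0 <= f i y) ->
  (forall i, \int[mu]_y (h i y * f i y)%:E = (c i)%:E)%E ->
  (\int[P]_w (\1_E w * \prod_(i in A) f i (Z i w))%:E =
   (e * \prod_(i in A) c i)%:E)%E.
Proof.
move=> mE e0 mZ dh rect f c mf f0 fc.
(* The induction is on a list [l] of the indices at which [f i] need not be an indicator. *)
have [l] : exists l : seq I, forall i, i \notin l ->
    exists B : set (measurableTypeR R), measurable B /\ f i = \1_B.
  by exists (enum I) => i; rewrite mem_enum.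
elim: l f c mf f0 fc => [|k l IHl] f c mf f0 fc fl.
  have /choice[B HB] : forall i, exists B : set (measurableTypeR R),
      measurable B /\ f i = \1_B by move=> i; exact: fl.
  have mB i : measurable (B i) by case: (HB i).
  transitivity (\int[P]_w (\1_(E `&` [set w | forall i, i \in A -> B i (Z i w)]) w)%:E)%E.
    apply: eq_integral => w _; congr EFin.
    rewrite indicI /=; congr (_ * _).
    have [H|H] := pselect (forall i, i \in A -> B i (Z i w)).
      rewrite [RHS]indicE mem_set//.
      by apply: big1 => i iA; rewrite (HB i).2 indicE mem_set//; exact: H.
    have [i Hi] : exists i, ~ (i \in A -> B i (Z i w)) by exact/existsNP.
    have /not_implyP[iA nB] := Hi.
    rewrite [RHS]indicE memNset//.
    by rewrite (bigD1 i)//= (HB i).2 indicE memNset// mul0r.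
  rewrite integral_indic//; last first.
    apply: measurableI => //.
    rewrite (_ : [set w | _] = \bigcap_(i in [set` A]) (Z i @^-1` B i))//.
    apply: fin_bigcap_measurable => // i _.
    by rewrite -[X in measurable X]setTI; exact: mZ.
  rewrite setIT rect// EFinM; congr (_ * _)%E.
  rewrite -prodEFin; apply: eq_bigr => i _.
  have [<- _] := density_integral_set (dh i) (mB i).
  by rewrite -fc (HB i).2.
pose upd (X : Type) (F : I -> X) x i := if i == k then x else F i.
have updk X F (x : X) : upd X F x k = x by rewrite /upd eqxx.
(* The induction hypothesis with an indicator [g] in place of [f k], so that [k] leaves the list. *)
have IHk (g : measurableTypeR R -> R) (cg : R) :
    measurable_fun [set: measurableTypeR R] g ->
    (exists B, measurable B /\ g = \1_B) -> (forall y, 0 <= g y) ->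
    (\int[mu]_y (h k y * g y)%:E = cg%:E)%E ->
    (\int[P]_w (\1_E w * \prod_(i in A) upd _ f g i (Z i w))%:E =
      (e * \prod_(i in A) upd _ c cg i)%:E)%E.
  move=> mg gB g0 hg; apply: IHl => [i|i y|i|i il]; rewrite /upd; case: eqP => // ik.
  - by rewrite ik.
  - by apply: fl; rewrite in_cons negb_or il andbT; exact/eqP.
(* Outside [A] the factor [f k] does not occur, so the constant 1 can replace it: it is the
   indicator of the full set, with mean 1 under the density [h k]. *)
have [kA|kA] := boolP (k \in A); last first.
  have [_ _ hk1] := dh k.
  have := IHk (cst 1) 1 (measurable_cst _).
  have -> : \prod_(i in A) upd _ c 1 i = \prod_(i in A) c i.
    by apply: eq_bigr => i iA; rewrite /upd; case: eqP iA => // ->; rewrite (negPf kA).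
  move <-.
  - apply: eq_integral => w _; congr (_ * _)%:E.
    by apply: eq_bigr => i iA; rewrite /upd; case: eqP iA => // ->; rewrite (negPf kA).
  - by exists setT; split => //; rewrite indicT.
  - by move=> ?.
  - by under eq_integral do rewrite mulr1.
have mprod : measurable_fun [set: T]
    (fun w => \1_E w * \prod_(i in A | i != k) f i (Z i w)).
  apply: measurable_funM; first exact: measurable_indic.
  under eq_fun do rewrite -big_filter.
  by apply: measurable_prod => i _; exact: measurableT_comp.
(* The density of coordinate [k], scaled by the contributions of [E] and of the other coordinates.
   On [T] it corresponds to the weight formed by [\1_E] and the other factors. *)
pose H u := (e * \prod_(i in A | i != k) c i) * h k u.
have c0 i : 0 <= c i.
  rewrite -lee_fin -fc; apply: integral_ge0 => y _.
  by have [_ hi0 _] := dh i; rewrite lee_fin mulr_ge0.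
have [mhk hk0 _] := dh k.
have mH : measurable_fun [set: measurableTypeR R] (H : measurableTypeR R -> R).
  by apply: measurable_funM => //; exact: measurable_cst.
have H0 u : 0 <= H u by rewrite /H !mulr_ge0// prodr_ge0.
have Hint (g : measurableTypeR R -> R) cg : measurable_fun [set: measurableTypeR R] g ->
    (forall y, 0 <= g y) -> (\int[mu]_y (h k y * g y)%:E = cg%:E)%E ->
    (\int[mu]_u (H u * g u)%:E = (e * \prod_(i in A | i != k) c i * cg)%:E)%E.
  move=> mg g0 hg; rewrite EFinM -hg -ge0_integralZl//.
  - by apply: eq_integral => u _; rewrite /H -mulrA EFinM.
  - by apply/measurable_EFinP; exact: measurable_funM.
  - by move=> u _; rewrite lee_fin mulr_ge0.
  - by rewrite lee_fin mulr_ge0// prodr_ge0.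
transitivity (\int[P]_w
    ((\1_E w * \prod_(i in A | i != k) f i (Z i w)) * f k (Z k w))%:E)%E.
  by apply: eq_integral => w _; rewrite (bigD1 k)//=; congr EFin; ring.
rewrite (eq_weighted_integral (mu := mu) (H := H) (W := id))//; last 2 first.
- by move=> w; rewrite mulr_ge0// prodr_ge0.
- move=> B mB.
  have [hB1 hB2] := density_integral_set (dh k) mB.
  rewrite (Hint _ (fine (\int[mu]_(y in B) (h k y)%:E)))//; last first.
  - by rewrite hB1 fineK.
  have := IHk \1_B (fine (\int[mu]_(y in B) (h k y)%:E)).
  rewrite (bigD1 k)//= updk => IHB.
  transitivity (\int[P]_w (\1_E w * \prod_(i in A) upd _ f \1_B i (Z i w))%:E)%E.
    apply: eq_integral => w _; rewrite [in RHS](bigD1 k)//= updk; apply: congr1.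
    rewrite -mulrA; congr (_ * _); rewrite mulrC; congr (_ * _).
    by apply: eq_bigr => i /andP[_ ik]; rewrite /upd (negPf ik).
  rewrite IHB//.
  + apply: congr1; rewrite -mulrA; congr (_ * _); rewrite mulrC; congr (_ * _).
    by apply: eq_bigr => i /andP[_ ik]; rewrite /upd (negPf ik).
  + by exists B.
  + by rewrite hB1 fineK.
by rewrite (Hint _ (c k))// [in RHS](bigD1 k)//=; apply: congr1; ring.
Qed.

(** * Expectations of products and sums over the sampled entries *)

Section sampled_observations.
Context {R : realType} {n1 n2 : nat} d (T : measurableType d).
Variables (P : probability T R) (mu : {measure set (measurableTypeR R) -> \bar R}).
Variables (p : R -> R -> R) (Xstar : 'M[R]_(n1, n2)) (gamma : R).
Variables (S : T -> {set 'I_n1 * 'I_n2}) (Y : T -> 'M[R]_(n1, n2)).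
Hypothesis p_density : forall x, is_density mu (p x).
Hypothesis S_law : bernoulli_sampling P gamma S.
Hypothesis Y_law : observation_law P mu p Xstar S Y.
Local Notation I := ('I_n1 * 'I_n2)%type.

(** Splitting over the finitely many values of [S] replaces the random index set by fixed ones, for
    measurability and for integrals alike. *)
Lemma sampled_decomposition (F : {set I} -> T -> R) w :
  F (S w) w = \sum_(s : {set I}) \1_[set w | S w = s] w * F s w.
Proof.
rewrite (bigD1 (S w))//= indicE mem_set// mul1r big1 ?addr0// => s sSw.
by rewrite indicE memNset ?mul0r//= => /esym/eqP; rewrite (negPf sSw).
Qed.

Lemma measurable_fun_sampled (F : {set I} -> T -> R) :
  (forall s, measurable_fun [set: T] (F s)) ->
  measurable_fun [set: T] (fun w => F (S w) w).
Proof.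
move=> mF; under eq_fun do rewrite sampled_decomposition.
apply: measurable_sum => s; apply: measurable_funM => //.
by apply: measurable_indic; have [] := S_law s.
Qed.

Variables (f : I -> measurableTypeR R -> R).
Hypothesis mf : forall ij, measurable_fun [set: measurableTypeR R] (f ij).

Let mfY ij : measurable_fun [set: T] (fun w => f ij (Y w ij.1 ij.2)).
Proof.
by apply: (measurableT_comp (mf ij)); case: ij => i j; exact: Y_law.1.
Qed.

Lemma measurable_sum_sampled :
  measurable_fun [set: T] (fun w => \sum_(ij in S w) f ij (Y w ij.1 ij.2)).
Proof.
apply: (measurable_fun_sampled
  (F := fun s w => \sum_(ij in s) f ij (Y w ij.1 ij.2))) => s.
by under eq_fun do rewrite -big_filter; exact: measurable_sum.
Qed.

Lemma measurable_prod_sampled :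
  measurable_fun [set: T] (fun w => \prod_(ij in S w) f ij (Y w ij.1 ij.2)).
Proof.
apply: (measurable_fun_sampled
  (F := fun s w => \prod_(ij in s) f ij (Y w ij.1 ij.2))) => s.
by under eq_fun do rewrite -big_filter; exact: measurable_prod.
Qed.

Hypothesis f0 : forall ij y, 0 <= f ij y.

(** Given [S = s], the expectation is the product of [c] over [s]. Summing over [s] with the
    Bernoulli weights expands the product of the sums [gamma * c ij + (1 - gamma)], one choice per
    entry. *)
Lemma expectation_prod_sampled (c : I -> R) :
  (forall ij, \int[mu]_y (p (Xstar ij.1 ij.2) y * f ij y)%:E = (c ij)%:E)%E ->
  (\int[P]_w (\prod_(ij in S w) f ij (Y w ij.1 ij.2))%:E =
   (\prod_ij (1 - gamma + gamma * c ij))%:E)%E.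
Proof.
move=> fc.
have mS s : measurable [set w | S w = s] by have [] := S_law s.
pose e (s : {set I}) := \prod_ij (if ij \in s then gamma else 1 - gamma).
have Pe s : P [set w | S w = s] = (e s)%:E by have [] := S_law s.
transitivity (\int[P]_w (\sum_(s : {set I})
    (\1_[set w | S w = s] w * \prod_(ij in s) f ij (Y w ij.1 ij.2))%:E))%E.
  apply: eq_integral => w _; rewrite sumEFin; congr EFin.
  exact: (sampled_decomposition
    (fun s w => \prod_(ij in s) f ij (Y w ij.1 ij.2))).
rewrite ge0_integral_sum//; last 2 first.
- move=> s; apply/measurable_EFinP; apply: measurable_funM.
    exact: measurable_indic.
  by under eq_fun do rewrite -big_filter; exact: measurable_prod.
- by move=> s w _; rewrite lee_fin mulr_ge0// prodr_ge0.
transitivity (\sum_(s : {set I}) (e s * \prod_(ij in s) c ij)%:E)%E.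
  apply: eq_bigr => s _.
  apply: (integral_prod_rectangles (Z := fun ij w => Y w ij.1 ij.2)
    (h := fun ij => p (Xstar ij.1 ij.2)) (mu := mu)) => //.
  - by rewrite -lee_fin -Pe.
  - by case=> i j; exact: Y_law.1.
  - by move=> B mB; rewrite -Pe; exact: Y_law.2.
rewrite sumEFin; congr EFin.
under [RHS]eq_bigr do rewrite addrC.
rewrite [RHS]bigA_distr; apply: eq_bigr => s _.
rewrite /e [X in _ * X]big_mkcond -big_split; apply: eq_bigr => ij _ /=.
by case: ifPn => _; rewrite ?mulr1.
Qed.

End sampled_observations.

Lemma expectation_sampled_entry {R : realType} {n1 n2 : nat} d
    (T : measurableType d) (P : probability T R)
    (mu : {measure set (measurableTypeR R) -> \bar R}) (p : R -> R -> R)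
    (Xstar : 'M[R]_(n1, n2)) (gamma : R)
    (S : T -> {set 'I_n1 * 'I_n2}) (Y : T -> 'M[R]_(n1, n2)) ij
    (f : measurableTypeR R -> R) (c : R) :
  (forall x, is_density mu (p x)) -> bernoulli_sampling P gamma S ->
  observation_law P mu p Xstar S Y ->
  measurable_fun [set: measurableTypeR R] f -> (forall y, 0 <= f y) ->
  (\int[mu]_y (p (Xstar ij.1 ij.2) y * f y)%:E = c%:E)%E ->
  (\int[P]_w (if ij \in S w then f (Y w ij.1 ij.2) else 0)%:E =
   (gamma * c)%:E)%E.
Proof.
move=> p_density S_law Y_law mf f0 fc.
(* 1 + f is used because the expectation of a product only sees a factor
   through 1 - gamma + gamma c. *)
pose F kl y := if kl == ij then 1 + f y else 1.
have mF kl : measurable_fun [set: measurableTypeR R] (F kl).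
  rewrite /F; case: eqP => _; last exact: measurable_cst.
  by apply: measurable_funD => //; exact: measurable_cst.
have F0 kl y : 0 <= F kl y by rewrite /F; case: ifP => // _; rewrite addr_ge0.
have FE w : \prod_(kl in S w) F kl (Y w kl.1 kl.2) =
    1 + (if ij \in S w then f (Y w ij.1 ij.2) else 0).
  have [ijS|ijS] := boolP (ij \in S w).
    rewrite (bigD1 ij)//= /F eqxx big1 ?mulr1// => kl /andP[_ /negPf ->] //.
  rewrite addr0 big1// => kl klS; rewrite /F; case: eqP => // klij.
  by rewrite -klij klS in ijS.
have mind : measurable_fun [set: T]
    (fun w => if ij \in S w then f (Y w ij.1 ij.2) else 0).
  rewrite (_ : (fun _ => _) =
    (fun w => \prod_(kl in S w) F kl (Y w kl.1 kl.2) - 1)); last first.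
    by apply/funext => w; rewrite FE addrAC subrr add0r.
  apply: measurable_funB => //.
  exact: (measurable_prod_sampled S_law Y_law mF).
have := expectation_prod_sampled p_density S_law Y_law mF F0
  (c := fun kl => if kl == ij then 1 + c else 1).
rewrite (bigD1 ij)//= eqxx [X in _ * X]big1 ?mulr1; last first.
  by move=> kl /negPf ->; rewrite mulr1 subrK.
under eq_integral do rewrite FE EFinD.
rewrite ge0_integralD//; last 2 first.
- by move=> w _; case: ifP => // _; rewrite lee_fin.
- exact/measurable_EFinP.
have -> : (\int[P]_w 1%:E = 1)%E.
  by rewrite integral_cst// mul1e; exact: probability_setT.
move=> H.
have {}H : (1%:E + \int[P]_w (if ij \in S w then f (Y w ij.1 ij.2) else 0)%:E =
    (1 - gamma + gamma * (1 + c))%:E)%E.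
  apply: H => kl; have [_ h0 h1] := p_density (Xstar kl.1 kl.2).
  have [mh _ _] := p_density (Xstar kl.1 kl.2).
  rewrite /F; case: eqP => [->|_]; last by under eq_integral do rewrite mulr1.
  under eq_integral do rewrite mulrDr mulr1 EFinD.
  have [mh' h0' h1'] := p_density (Xstar ij.1 ij.2).
  rewrite ge0_integralD//.
  - by rewrite h1' fc.
  - by move=> y _; rewrite lee_fin.
  - exact/measurable_EFinP.
  - by move=> y _; rewrite lee_fin mulr_ge0.
  - by apply/measurable_EFinP; exact: measurable_funM.
move/(congr1 (fun x => x - 1%:E)%E): H.
by rewrite addeAC subee// add0e => ->; rewrite -EFinB; apply: congr1; ring.
Qed.

Section sampled_entries.
Context {R : realType} {n1 n2 : nat} d (T : measurableType d).
Variables (P : probability T R) (mu : {measure set (measurableTypeR R) -> \bar R}).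
Variables (p : R -> R -> R) (Xstar : 'M[R]_(n1, n2)) (gamma : R).
Variables (S : T -> {set 'I_n1 * 'I_n2}) (Y : T -> 'M[R]_(n1, n2)).
Hypothesis p_density : forall x, is_density mu (p x).
Hypothesis S_law : bernoulli_sampling P gamma S.
Hypothesis Y_law : observation_law P mu p Xstar S Y.

Lemma measurable_sampled_entry ij (f : measurableTypeR R -> R) :
  measurable_fun [set: measurableTypeR R] f ->
  measurable_fun [set: T] (fun w => if ij \in S w then f (Y w ij.1 ij.2) else 0).
Proof.
move=> mf; apply: (measurable_fun_sampled S_law
  (F := fun s w => if ij \in s then f (Y w ij.1 ij.2) else 0)) => s.
case: (boolP (ij \in s)) => _; last exact: measurable_cst.
by apply: (measurableT_comp mf); case: ij => i j; exact: Y_law.1.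
Qed.

Lemma expectation_sum_sampled (f : 'I_n1 * 'I_n2 -> measurableTypeR R -> R)
    (c : 'I_n1 * 'I_n2 -> R) :
  (forall ij, measurable_fun [set: measurableTypeR R] (f ij)) ->
  (forall ij y, 0 <= f ij y) ->
  (forall ij, \int[mu]_y (p (Xstar ij.1 ij.2) y * f ij y)%:E = (c ij)%:E)%E ->
  (\int[P]_w (\sum_(ij in S w) f ij (Y w ij.1 ij.2))%:E =
   (gamma * \sum_ij c ij)%:E)%E.
Proof.
move=> mf f0 fc.
under eq_integral do rewrite big_mkcond -sumEFin.
rewrite ge0_integral_sum//; last 2 first.
- by move=> ij; apply/measurable_EFinP; exact: measurable_sampled_entry.
- by move=> ij w _; case: ifP => // _; rewrite lee_fin.
rewrite mulr_sumr -sumEFin; apply: eq_bigr => ij _.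
exact: (expectation_sampled_entry p_density S_law Y_law).
Qed.

(** The indicator of a sampled observation falling in [B ij] has expectation [gamma] times 0, so it
    vanishes almost surely; there are finitely many entries. This discards observations at which a
    density is zero. *)
Lemma ae_sampled_entry (B : 'I_n1 * 'I_n2 -> set (measurableTypeR R)) :
  (forall ij, measurable (B ij)) ->
  (forall ij, \int[mu]_y (p (Xstar ij.1 ij.2) y * \1_(B ij) y)%:E = 0)%E ->
  {ae P, forall w ij, ij \in S w -> ~ B ij (Y w ij.1 ij.2)}.
Proof.
move=> mB intB; apply: filter_forall => ij.
have mind := measurable_sampled_entry ij (measurable_indic (mB ij)).
have := expectation_sampled_entry p_density S_law Y_law
  (measurable_indic (mB ij)) _ (intB ij).
rewrite mulr0 => int0.
have /ae_eq_integral_abs : measurable_fun [set: T] (EFin \o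
    (fun w => if ij \in S w then \1_(B ij) (Y w ij.1 ij.2) else 0 : R)).
  exact/measurable_EFinP.
move=> /(_ P measurableT)[+ _].
under eq_integral.
  move=> w _; rewrite /= ger0_norm; last by case: ifP.
  over.
rewrite int0// => /(_ erefl); apply: filterS => w /= /(_ I) H ijS BY.
by move: H; rewrite ijS indicE mem_set// => -[/eqP]; rewrite oner_eq0.
Qed.

End sampled_entries.

(** * Elementary exponential inequalities *)

Lemma expR_mul_le_convex (R : realType) (s x : R) : 0 <= s <= 1 ->
  expR (s * x) <= 1 - s + s * expR x.
Proof.
move=> /andP[s0 s1].
(* [h1] and [h2] say that the tangent of the exponential at [s * x] lies below it at [x] and at 0.
   Averaging with weights [s] and [1 - s] cancels the slopes. *)
have h1 : expR (s * x) * (1 + (1 - s) * x) <= expR x.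
  rewrite [leRHS](_ : _ = expR (s * x) * expR ((1 - s) * x)).
    by rewrite ler_wpM2l ?expR_ge0// expR_ge1Dx.
  by rewrite -expRD; congr expR; ring.
have h2 : expR (s * x) * (1 - s * x) <= 1.
  rewrite [leRHS](_ : _ = expR (s * x) * expR (- (s * x))).
    by rewrite ler_wpM2l ?expR_ge0// expR_ge1Dx.
  by rewrite -expRD subrr expR0.
have s1' : 0 <= 1 - s by rewrite subr_ge0.
have := lerD (ler_wpM2l s0 h1) (ler_wpM2l s1' h2).
rewrite mulr1 [leRHS]addrC; apply: le_trans.
by rewrite le_eqVlt; apply/orP; left; apply/eqP; ring.
Qed.

(** Here exp x >= 1 + x, and (1 + x) (1 - x / 2) = 1 + x (1 - x) / 2 is at least 1 on the unit
    interval. *)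
Lemma expRN_le (R : realType) (x : R) : 0 <= x <= 1 -> expR (- x) <= 1 - x / 2.
Proof.
move=> /andP[x0 x1]; rewrite expRN.
have e0 : 0 < 1 + x by lra.
apply: (@le_trans _ _ (1 + x)^-1).
  by rewrite lef_pV2 ?posrE ?expR_gt0// expR_ge1Dx.
rewrite -[leLHS]mul1r ler_pdivrMr//; nra.
Qed.

(** * Affinity, divergence and likelihood ratio for one pair of densities *)

Section hellinger_kullback.
Context {R : realType}.
Variable mu : {measure set (measurableTypeR R) -> \bar R}.
Variables f g : R -> R.
Hypotheses (df : is_density mu f) (dg : is_density mu g).

Let mf : measurable_fun [set: measurableTypeR R] (f : measurableTypeR R -> R).
Proof. by case: df. Qed.
Let mg : measurable_fun [set: measurableTypeR R] (g : measurableTypeR R -> R).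
Proof. by case: dg. Qed.
Let f0 y : 0 <= f y. Proof. by case: df. Qed.
Let g0 y : 0 <= g y. Proof. by case: dg. Qed.
Let intf : (\int[mu]_y (f y)%:E = 1)%E. Proof. by case: df. Qed.
Let intg : (\int[mu]_y (g y)%:E = 1)%E. Proof. by case: dg. Qed.

Lemma affinityE : affinity mu g f = (\int[mu]_y (Num.sqrt (f y * g y))%:E)%E.
Proof.
apply: eq_integral => y _; rewrite -EFinM; congr EFin.
have [->|gn0] := eqVneq (g y) 0; first by rewrite mul0r mulr0 sqrtr0.
rewrite -{1}(@ger0_norm _ (g y))// -sqrtr_sqr -sqrtrM ?sqr_ge0//.
by congr Num.sqrt; field.
Qed.

Let msqrt : measurable_fun [set: measurableTypeR R]
  (fun y : measurableTypeR R => Num.sqrt (f y * g y)).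
Proof.
under eq_fun do rewrite -powR12_sqrt ?mulr_ge0//.
exact: (measurableT_comp (measurable_powR _) (measurable_funM mf mg)).
Qed.

(** The upper bound integrates the mean inequality sqrt (f g) <= (f + g) / 2. *)
Lemma affinity_fin : exists2 A : R, affinity mu g f = A%:E & 0 <= A <= 1.
Proof.
have a0 : (0 <= affinity mu g f)%E.
  by rewrite affinityE; apply: integral_ge0 => y _; rewrite lee_fin sqrtr_ge0.
have a1 : (affinity mu g f <= 1)%E.
  rewrite affinityE.
  apply: (@le_trans _ _ (\int[mu]_y ((2^-1)%:E * ((f y)%:E + (g y)%:E)))%E).
    apply: ge0_le_integral => //.
    - exact/measurable_EFinP.
    - apply: measurable_funeM; apply: emeasurable_funD; exact/measurable_EFinP.
    - move=> y _; rewrite -EFinD -EFinM lee_fin.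
      have h : 0 <= 2^-1 * (f y + g y) by rewrite mulr_ge0// addr_ge0.
      rewrite -(ger0_norm h) -sqrtr_sqr ler_wsqrtr//.
      by have := sqr_ge0 (f y - g y); nra.
  rewrite ge0_integralZl//; last 2 first.
  - by apply: emeasurable_funD; exact/measurable_EFinP.
  - by move=> y _; rewrite -EFinD lee_fin addr_ge0.
  rewrite ge0_integralD//; last 4 first.
  - by move=> y _; rewrite lee_fin.
  - exact/measurable_EFinP.
  - by move=> y _; rewrite lee_fin.
  - exact/measurable_EFinP.
  by rewrite intf intg -EFinD -EFinM lee_fin; lra.
case E : (affinity mu g f) a0 a1 => [A| |]//.
by rewrite !lee_fin => A0 A1; exists A => //; rewrite A0.
Qed.

(** Multiplied by [+oo], this carries the infinite part of the KL integrand. The remaining real part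
    is 0 wherever [g] vanishes, by the conventions x / 0 = 0 and ln 0 = 0. *)
Let null y := f y * \1_[set y | g y = 0] y.

Let KL_integrandE y : ((f y)%:E * lne ((f y)%:E / (g y)%:E) =
  (f y * ln (f y / g y))%:E + +oo * (null y)%:E)%E.
Proof.
rewrite /null indicE.
have [fy0|fyn0] := eqVneq (f y) 0; first by rewrite fy0 !mul0r mul0e mule0 adde0.
have fpos : 0 < f y by rewrite lt_def fyn0/=.
have [gy0|gyn0] := eqVneq (g y) 0.
  rewrite gy0 mem_set//= mulr1 inve0 gt0_muley ?lte_fin//= gt0_muley ?lte_fin//.
  by rewrite gt0_mulye ?lte_fin// addey.
have gpos : 0 < g y by rewrite lt_def gyn0/=.
rewrite memNset/=; last exact/eqP.
rewrite mulr0 mule0 adde0 inver (negPf gyn0) -EFinM lne_EFin//.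
by rewrite divr_gt0.
Qed.

Let mlog : measurable_fun [set: measurableTypeR R]
  (fun y : measurableTypeR R => ln (f y / g y)).
Proof.
apply: measurableT_comp; first exact: measurable_ln.
apply: measurable_funM => //.
under eq_fun do rewrite -powR_inv1//.
exact: (measurableT_comp (measurable_powR _) mg).
Qed.

Let mg0 : measurable [set y : measurableTypeR R | g y = 0].
Proof.
rewrite (_ : [set _ | _] = g @^-1` [set 0])//.
by rewrite -[X in measurable X]setTI; exact: mg.
Qed.

Let mnull : measurable_fun [set: measurableTypeR R] (null : measurableTypeR R -> R).
Proof. by apply: measurable_funM => //; exact: measurable_indic. Qed.

Let k := (fun y => (f y * ln (f y / g y))%:E + +oo * (null y)%:E)%E.

Let KLE : KL mu f g = (\int[mu]_y k y)%E.
Proof. by apply: eq_integral => y _; exact: KL_integrandE. Qed.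

Let null0 y : 0 <= null y.
Proof. by rewrite mulr_ge0. Qed.

Let null_or y : (0 < null y /\ g y = 0) \/ null y = 0.
Proof.
have [gy0|gyn0] := eqVneq (g y) 0; last first.
  by right; rewrite /null indicE memNset ?mulr0//; exact/eqP.
have [fy0|fyn0] := eqVneq (f y) 0; first by right; rewrite /null fy0 mul0r.
by left; split=> //; rewrite /null indicE mem_set//= mulr1 lt_def fyn0/=.
Qed.

Let mk : measurable_fun [set: measurableTypeR R] (k : measurableTypeR R -> \bar R).
Proof.
apply: emeasurable_funD; last by apply: measurable_funeM; exact/measurable_EFinP.
by apply/measurable_EFinP; exact: measurable_funM.
Qed.

(** From ln x <= x at x = g / f. It bounds the negative part of the KL integrand by [g], whose
    integral is 1. *)
Let lg y : f y * ln (g y / f y) <= g y.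
Proof.
have [->|fyn0] := eqVneq (f y) 0; first by rewrite mul0r.
have fpos : 0 < f y by rewrite lt_def fyn0/=.
rewrite -[leRHS](_ : f y * (g y / f y) = _); last by field.
rewrite ler_wpM2l//.
have [gy0|gyn0] := eqVneq (g y) 0; first by rewrite gy0 mul0r ln0.
by apply/ltW/ln_sublinear; rewrite divr_gt0// lt_def gyn0/=.
Qed.

Let logN y : ln (g y / f y) = - ln (f y / g y).
Proof.
have [->|fyn0] := eqVneq (f y) 0; first by rewrite invr0 mulr0 mul0r ln0// oppr0.
have [->|gyn0] := eqVneq (g y) 0; first by rewrite invr0 mulr0 mul0r ln0// oppr0.
have fpos : 0 < f y by rewrite lt_def fyn0/=.
have gpos : 0 < g y by rewrite lt_def gyn0/=.
by rewrite -lnV ?posrE ?divr_gt0// invf_div.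
Qed.

Let kneg y : k^\-%E y = (f y * Num.max (- ln (f y / g y)) 0)%:E.
Proof.
rewrite funenegE /k; case: (null_or y) => [[n0 gy0]|->].
  rewrite gy0 invr0 mulr0 ln0// mulr0 add0e gt0_mulye//= oppr0 maxxx mulr0.
  by rewrite maxNye.
by rewrite mule0 adde0 -EFinN -EFin_max -mulrN maxr_pMr// mulr0.
Qed.

Let kpos y : ((f y * Num.max (ln (f y / g y)) 0)%:E <= k^\+%E y)%E.
Proof.
rewrite funeposE /k; case: (null_or y) => [[n0 gy0]|->].
  by rewrite gy0 invr0 mulr0 ln0// maxxx mulr0 le_max lexx orbT.
by rewrite mule0 adde0 -EFin_max maxr_pMr// mulr0.
Qed.

Let kpos_null y : (+oo * (null y)%:E <= k^\+%E y)%E.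
Proof.
rewrite funeposE /k; case: (null_or y) => [[n0 gy0]|->].
  by rewrite gy0 invr0 mulr0 ln0// mulr0 add0e le_max lexx.
by rewrite mule0 le_max lexx orbT.
Qed.

Variable C : R.
Hypothesis KL_le : (KL mu f g <= C%:E)%E.

Let intkneg : (\int[mu]_y k^\-%E y <= 1)%E.
Proof.
rewrite -intg; apply: ge0_le_integral => //.
- exact: measurable_funeneg.
- exact/measurable_EFinP.
- move=> y _; rewrite kneg lee_fin maxr_pMr// mulr0 ge_max g0 andbT.
  by rewrite -logN.
Qed.

(** The negative part has a finite integral, so an infinite positive part would make the divergence
    [+oo], against [KL_le]. *)
Let intkpos : (\int[mu]_y k^\+%E y < +oo)%E.
Proof.
rewrite ltey; apply: contraPneq KL_le => /= kp.
rewrite KLE integralE kp.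
have : (\int[mu]_y k^\-%E y \is a fin_num)%E.
  rewrite ge0_fin_numE; last by apply: integral_ge0 => y _; exact: funeneg_ge0.
  by apply: (le_lt_trans intkneg); exact: ltry.
by move=> /fineK <-; rewrite addye//.
Qed.

Let ik : mu.-integrable [set: measurableTypeR R] k.
Proof.
apply/integrableP; split => //.
rewrite -[fun x => _]/(abse \o k) fune_abse ge0_integralD//; last 2 first.
- exact: measurable_funepos.
- exact: measurable_funeneg.
rewrite lte_add_pinfty//.
by apply: (le_lt_trans intkneg); exact: ltry.
Qed.

(** If [f] had positive mass where [g] vanishes, [+oo] times that mass would be at most the integral
    of the positive part of the KL integrand, which is finite. *)
Lemma KL_abs_cont : (\int[mu]_y (f y * \1_[set y | g y = 0] y)%:E = 0)%E.
Proof.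
have n0 : (0 <= \int[mu]_y (null y)%:E)%E.
  by apply: integral_ge0 => y _; rewrite lee_fin.
move: n0; rewrite le_eqVlt => /orP[/eqP <- //|n0].
suff : (+oo * \int[mu]_y (null y)%:E < +oo :> \bar R)%E by rewrite gt0_mulye.
rewrite -ge0_integralZl//; last 2 first.
- exact/measurable_EFinP.
- by move=> y _; rewrite lee_fin.
apply: (le_lt_trans _ intkpos); apply: ge0_le_integral => //.
- by move=> y _; rewrite mule_ge0// lee_fin.
- by apply: measurable_funeM; exact/measurable_EFinP.
- exact: measurable_funepos.
Qed.

(** The log-ratio is split into two nonnegative functions of finite mean, to which the expectation
    formulas over sampled entries apply. The last conjunct is an inequality because the real
    log-ratio omits the infinite part. *)
Lemma KL_posneg : exists Kp Kn : R,
  [/\ (\int[mu]_y (f y * Num.max (ln (f y / g y)) 0)%:E = Kp%:E)%E,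
      (\int[mu]_y (f y * Num.max (- ln (f y / g y)) 0)%:E = Kn%:E)%E
    & ((Kp - Kn)%:E <= KL mu f g)%E].
Proof.
have p0 : (0 <= \int[mu]_y (f y * Num.max (ln (f y / g y)) 0)%:E)%E.
  by apply: integral_ge0 => y _; rewrite lee_fin mulr_ge0// le_max lexx orbT.
have n0 : (0 <= \int[mu]_y (f y * Num.max (- ln (f y / g y)) 0)%:E)%E.
  by apply: integral_ge0 => y _; rewrite lee_fin mulr_ge0// le_max lexx orbT.
have p1 : (\int[mu]_y (f y * Num.max (ln (f y / g y)) 0)%:E <=
    \int[mu]_y k^\+%E y)%E.
  apply: ge0_le_integral => //.
  - by move=> y _; rewrite lee_fin mulr_ge0// le_max lexx orbT.
  - apply/measurable_EFinP; apply: measurable_funM => //.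
    by apply: measurable_maxr => //; exact: measurable_cst.
  - exact: measurable_funepos.
have nE : (\int[mu]_y (f y * Num.max (- ln (f y / g y)) 0)%:E =
    \int[mu]_y k^\-%E y)%E by apply: eq_integral => y _; rewrite kneg.
have pfin := le_lt_trans p1 intkpos.
have nfin : (\int[mu]_y (f y * Num.max (- ln (f y / g y)) 0)%:E < +oo)%E.
  by rewrite nE; apply: (le_lt_trans intkneg); exact: ltry.
exists (fine (\int[mu]_y (f y * Num.max (ln (f y / g y)) 0)%:E)%E).
exists (fine (\int[mu]_y (f y * Num.max (- ln (f y / g y)) 0)%:E)%E).
rewrite !fineK ?ge0_fin_numE//; split => //.
rewrite EFinB !fineK ?ge0_fin_numE// KLE [leRHS]integralE nE.
exact: leeB.
Qed.

(* log (f / g) = -2 log (sqrt (g / f)) is bounded below by a tangent line of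
   -2 log at eps. *)
Lemma KL_ge_tangent (A eps : R) : affinity mu g f = A%:E -> 0 < eps ->
  ((2 - 2 * ln eps - 2 * A / eps)%:E <= KL mu f g)%E.
Proof.
rewrite affinityE => hA eps0.
have isq : mu.-integrable [set: measurableTypeR R]
    (EFin \o (fun y => Num.sqrt (f y * g y))).
  apply/integrableP; split; first exact/measurable_EFinP.
  under eq_integral do rewrite /= ger0_norm ?sqrtr_ge0//.
  by rewrite hA ltry.
have if_ : mu.-integrable [set: measurableTypeR R] (EFin \o f).
  apply/integrableP; split; first exact/measurable_EFinP.
  under eq_integral do rewrite /= ger0_norm//.
  by rewrite intf ltry.
have -> : ((2 - 2 * ln eps - 2 * A / eps)%:E =
  \int[mu]_y ((2 - 2 * ln eps)%:E * (f y)%:E +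
              (- 2 / eps)%:E * (Num.sqrt (f y * g y))%:E))%E.
  rewrite integralD//; last 2 first.
  - exact: integrableZl.
  - exact: integrableZl.
  rewrite !integralZl// intf hA -!EFinM -EFinD; congr EFin; ring.
rewrite KLE; apply: le_integral => //.
  by apply: integrableD => //; exact: integrableZl.
move=> y _; rewrite -!EFinM -EFinD /k.
have [fy0|fyn0] := eqVneq (f y) 0.
  by rewrite /null fy0 !mul0r sqrtr0 !mulr0 addr0 mule0 adde0.
have fpos : 0 < f y by rewrite lt_def fyn0/=.
have [gy0|gyn0] := eqVneq (g y) 0.
  rewrite /null indicE mem_set//= mulr1 gt0_mulye ?lte_fin//.
  by rewrite addey// leey.
have gpos : 0 < g y by rewrite lt_def gyn0/=.
rewrite /null indicE memNset/=; last exact/eqP.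
rewrite mulr0 mule0 adde0 lee_fin.
pose u := Num.sqrt (g y / f y).
have u0 : 0 < u by rewrite sqrtr_gt0 divr_gt0.
have uE : g y / f y = u * u by rewrite -expr2 sqr_sqrtr// ltW// divr_gt0.
have -> : Num.sqrt (f y * g y) = f y * u.
  rewrite (_ : f y * g y = f y ^+ 2 * (g y / f y)); last by field.
  by rewrite sqrtrM ?sqr_ge0// sqrtr_sqr ger0_norm.
have -> : ln (f y / g y) = - (2 * ln u).
  by rewrite -[LHS]opprK -logN uE lnM ?posrE//; ring.
have : ln (u / eps) <= u / eps - 1.
  rewrite -[X in ln X](subrKC 1) le_ln1Dx//.
  by rewrite -subr_gt0 opprK subrK divr_gt0.
rewrite ln_div ?posrE// => H.
rewrite [leLHS](_ : _ = f y * (2 - 2 * ln eps - 2 * (u / eps))); last by ring.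
by rewrite ler_wpM2l//; lra.
Qed.

(** The tangent bound is largest at [eps = A], where it equals -2 ln A. *)
Lemma affinity_KL : exists A : R, [/\ affinity mu g f = A%:E, 0 < A <= 1,
  ((- 2 * ln A)%:E <= KL mu f g)%E & - 2 * ln A <= C].
Proof.
have [A AE /andP[A0 A1]] := affinity_fin.
have Apos : 0 < A.
  (* With A = 0 the tangent bound would give 2 + 2 C <= C at [eps = exp (- C)] and 2 <= C at
     [eps = 1], which are incompatible. *)
  rewrite lt_def A0 andbT; apply/negP => /eqP A00.
  have := KL_ge_tangent AE (expR_gt0 (- C)).
  rewrite A00 mulr0 mul0r subr0 expRK => /le_trans/(_ KL_le); rewrite lee_fin.
  have := KL_ge_tangent AE (@ltr01 R).
  rewrite A00 mulr0 mul0r subr0 ln1 mulr0 subr0 => /le_trans/(_ KL_le).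
  by rewrite lee_fin; lra.
have KLA := KL_ge_tangent AE Apos.
have h : ((- 2 * ln A)%:E <= KL mu f g)%E.
  apply: le_trans KLA; rewrite lee_fin le_eqVlt; apply/orP; left; apply/eqP.
  by field; rewrite gt_eqF.
exists A; split => //; first by rewrite Apos.
by rewrite -lee_fin; apply: le_trans KL_le.
Qed.

(** With u = sqrt (g / f), the ratio to the power t is u^(2t), concave in u as 2t <= 1, hence below
    its tangent at u = A, which is A^(2t) (1 - 2t + 2t u / A). The mean of u under [f] is A, so the
    tangent integrates to K = A^(2t) = exp (- t (-2 ln A)), and [expRN_le] concludes. *)
Lemma likelihood_ratio_moment (A t : R) : affinity mu g f = A%:E -> 0 < A <= 1 ->
  0 < t <= 2^-1 -> t * (- 2 * ln A) <= 1 ->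
  exists2 c : R, (\int[mu]_y (f y * (g y / f y) `^ t)%:E = c%:E)%E &
    c <= 1 - t * (- 2 * ln A) / 2.
Proof.
rewrite affinityE => AE /andP[A0 A1] /andP[t0 t1] tA.
pose K := expR (2 * t * ln A).
have K0 : 0 <= K by exact: expR_ge0.
have le1 : (\int[mu]_y (f y * (g y / f y) `^ t)%:E <=
    \int[mu]_y ((K * (1 - 2 * t))%:E * (f y)%:E +
      (K * (2 * t / A))%:E * (Num.sqrt (f y * g y))%:E))%E.
  apply: ge0_le_integral => //.
  - by move=> y _; rewrite lee_fin mulr_ge0// powR_ge0.
  - apply/measurable_EFinP; apply: measurable_funM => //.
    apply: (measurableT_comp (measurable_powR t)).
    apply: measurable_funM => //.
    under eq_fun do rewrite -powR_inv1//.
    exact: (measurableT_comp (measurable_powR _) mf).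
  - by apply: emeasurable_funD; apply: measurable_funeM; exact/measurable_EFinP.
  move=> y _; rewrite -!EFinM -EFinD lee_fin.
  have [fy0|fyn0] := eqVneq (f y) 0; first by rewrite fy0 !mul0r sqrtr0 !mulr0 addr0.
  have fpos : 0 < f y by rewrite lt_def fyn0/=.
  have [gy0|gyn0] := eqVneq (g y) 0.
    rewrite gy0 mul0r mulr0 sqrtr0 mulr0 addr0 powR0 ?gt_eqF// mulr0.
    by rewrite !mulr_ge0//; lra.
  have gpos : 0 < g y by rewrite lt_def gyn0/=.
  pose u := Num.sqrt (g y / f y).
  have u0 : 0 < u by rewrite sqrtr_gt0 divr_gt0.
  have uE : g y / f y = u * u by rewrite -expr2 sqr_sqrtr// ltW// divr_gt0.
  have -> : Num.sqrt (f y * g y) = f y * u.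
    rewrite (_ : f y * g y = f y ^+ 2 * (g y / f y)); last by field.
    by rewrite sqrtrM ?sqr_ge0// sqrtr_sqr ger0_norm.
  have -> : (g y / f y) `^ t = K * expR (2 * t * ln (u / A)).
    rewrite uE /powR gt_eqF ?mulr_gt0// -expRD lnM ?posrE// ln_div ?posrE//.
    by congr expR; ring.
  have : expR (2 * t * ln (u / A)) <= 1 - 2 * t + 2 * t * (u / A).
    rewrite -[X in _ <= _ + _ * X](@lnK _ (u / A)) ?posrE ?divr_gt0//.
    by apply: expR_mul_le_convex; lra.
  move=> H; rewrite mulrA [leRHS](_ : _ = f y * K * (1 - 2 * t + 2 * t * (u / A))).
    by rewrite ler_wpM2l// mulr_ge0.
  ring.
have rhsE : (\int[mu]_y ((K * (1 - 2 * t))%:E * (f y)%:E +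
      (K * (2 * t / A))%:E * (Num.sqrt (f y * g y))%:E) = K%:E)%E.
  have K1 : 0 <= K * (1 - 2 * t) by rewrite mulr_ge0//; lra.
  have K2 : 0 <= K * (2 * t / A) by rewrite mulr_ge0// divr_ge0//; lra.
  rewrite ge0_integralD//; last 4 first.
  - by move=> y _; rewrite lee_fin mulr_ge0.
  - by apply: measurable_funeM; exact/measurable_EFinP.
  - by move=> y _; rewrite lee_fin mulr_ge0// sqrtr_ge0.
  - by apply: measurable_funeM; exact/measurable_EFinP.
  have mfE : measurable_fun [set: measurableTypeR R] (fun y => (f y)%:E).
    exact/measurable_EFinP.
  have mqE : measurable_fun [set: measurableTypeR R]
      (fun y => (Num.sqrt (f y * g y))%:E) by exact/measurable_EFinP.
  have e1 : (\int[mu]_y ((K * (1 - 2 * t))%:E * (f y)%:E) =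
      (K * (1 - 2 * t))%:E * 1%:E)%E.
    rewrite -[in RHS]intf; apply: ge0_integralZl => // y _.
    by rewrite lee_fin.
  have e2 : (\int[mu]_y ((K * (2 * t / A))%:E * (Num.sqrt (f y * g y))%:E) =
      (K * (2 * t / A))%:E * A%:E)%E.
    rewrite -[in RHS]AE; apply: ge0_integralZl => //.
  rewrite e1 e2.
  by rewrite -!EFinM -EFinD; congr EFin; field; rewrite gt_eqF.
rewrite rhsE in le1.
have ge0 : (0 <= \int[mu]_y (f y * (g y / f y) `^ t)%:E)%E.
  by apply: integral_ge0 => y _; rewrite lee_fin mulr_ge0// powR_ge0.
exists (fine (\int[mu]_y (f y * (g y / f y) `^ t)%:E)%E).
  by rewrite fineK// ge0_fin_numE//; apply: (le_lt_trans le1); exact: ltry.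
rewrite -lee_fin fineK; last first.
  by rewrite ge0_fin_numE//; apply: (le_lt_trans le1); exact: ltry.
apply: (le_trans le1); rewrite lee_fin.
rewrite /K (_ : 2 * t * ln A = - (t * (- 2 * ln A))); last by ring.
apply: expRN_le; rewrite tA andbT mulr_ge0//; first exact: ltW.
by have := ln_le0 A1; lra.
Qed.

End hellinger_kullback.

(** * Countable families, Kraft's inequality and existence of minimizers *)

Lemma countable_enumeration (U : choiceType) (D : set U) : countable D ->
  exists g : nat -> option U,
  [/\ forall n X, g n = Some X -> D X,
      forall X, D X -> exists n, g n = Some X
    & forall (R : realType) (k : U -> \bar R), (forall X, D X -> 0 <= k X)%E ->
      (\sum_(n <oo) oapp k 0 (g n) = \esum_(X in D) k X)%E].
Proof.
move=> /countable_injP[f finj].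
(* Index [n] holds the unique element of [D] sent to [n] by the injection [f], or [None]. No element
   is repeated, so series along [g] are sums over [D], even when [D] is finite or empty. *)
have /choice[g gP] : forall n, exists o : option U,
    forall X, o = Some X <-> D X /\ f X = n.
  move=> n.
  have [[X [DX fX]]|nX] := pselect (exists X, D X /\ f X = n); last first.
    by exists None => X; split=> // DX; case: nX; exists X.
  exists (Some X) => X'; split=> [[<-]//|[DX' fX']]; congr Some.
  by apply: finj; rewrite ?inE// fX fX'.
exists g; split => [n X /gP[]//|X DX|R k k0]; first by exists (f X); exact/gP.
have gk0 n : (0 <= oapp k 0 (g n))%E.
  by case E : (g n) => [X|]//=; apply: k0; have /gP[] := E.
rewrite nneseries_esumT// (_ : esum setT _ = \esum_(n in f @` D) oapp k 0%E (g n)).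
  rewrite (@reindex_esum R U nat D (f @` D) f _ (inj_bij finj)).
  apply: eq_esum => X DX; have -> : g (f X) = Some X by exact/gP.
  by [].
rewrite [RHS]esum_mkcond; apply: eq_esum => n _; case: ifPn => // nD.
case E : (g n) => [X|]//=; have /gP[DX fX] := E.
by move: nD; rewrite notin_setE => -[]; exists X.
Qed.

Lemma measurable_fun_countable_range d (T : measurableType d) d'
    (V : measurableType d') (U : choiceType) (D : set U) (h : T -> U)
    (phi : U -> V) :
  countable D -> (forall w, D (h w)) ->
  (forall X, D X -> measurable [set w | h w = X]) ->
  measurable_fun [set: T] (phi \o h).
Proof.
move=> /countable_enumeration[g [gD Dg _]] Dh mh _ B mB; rewrite setTI.
rewrite (_ : _ @^-1` B = \bigcup_n
  (if g n is Some X then [set w | h w = X /\ B (phi X)] else set0)).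
  apply: bigcupT_measurable => n; case E : (g n) => [X|]//.
  have [BX|nBX] := pselect (B (phi X)).
    rewrite (_ : [set _ | _] = [set w | h w = X]); first exact/mh/(gD n).
    by apply/seteqP; split=> w /= => [[]|].
  by rewrite (_ : [set _ | _] = set0)//; apply/seteqP; split=> w //= -[_ /nBX].
apply/seteqP; split => w /=.
  by have [n gn] := Dg _ (Dh w) => Bw; exists n => //; rewrite gn.
by move=> [n _]; case: (g n) => // X [/= ->].
Qed.

(** Each such element contributes at least 2^(-r) to a sum that is at most 1, so there are at most
    2^r of them. *)
Lemma finite_set_kraft (R : realType) (U : choiceType) (D : set U)
    (pen : U -> R) (r : R) :
  (\esum_(X in D) (2 `^ (- pen X))%:E <= 1)%E ->
  finite_set [set X | D X /\ pen X <= r].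
Proof.
move=> kraft; apply: contrapT => /infinite_set_fset inf.
pose e : R := 2 `^ (- r).
have e0 : 0 < e by exact: powR_gt0.
have [B BD cB] := inf (Num.truncn (e^-1)).+1.
set s : seq U := finmap.enum_fset B in cB.
have us : uniq s by exact: finmap.fset_uniq.
have : (((size s)%:R * e)%:E <= 1%:E :> \bar R)%E.
  apply: (le_trans _ kraft); apply: esum_ge; exists [set` s].
    by split; [apply/finite_seqP; exists s|apply: subset_trans BD _ => X []].
  rewrite -fsbig_seq//.
  apply: (@le_trans _ _ (\sum_(X <- s) e%:E)%E).
    by rewrite sumEFin lee_fin big_const_seq count_predT iter_addr_0 mulr_natl.
  rewrite !sumEFin lee_fin big_seq [leRHS]big_seq; apply: ler_sum => X XB.
  have [_ Xr] := BD _ XB.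
  by rewrite ler_powR// ?lerN2// ler1n.
rewrite lee_fin -ler_pdivlMr// div1r leNgt => /negP; apply.
by apply: lt_le_trans (truncnS_gt _) _; rewrite ler_nat.
Qed.

Lemma seq_argmin (R : realType) (U : eqType) (s : seq U) (f : U -> \bar R) X0 :
  X0 \in s -> exists2 X, X \in s & forall X', X' \in s -> (f X <= f X')%E.
Proof.
elim: s X0 => // X1 s IH X0 _.
have [->|] := eqVneq s [::].
  by exists X1; rewrite ?mem_seq1// => X'; rewrite mem_seq1 => /eqP ->.
case: s IH => // X2 s IH _; have [X Xs Xmin] := IH X2 (mem_head _ _).
have [h|h] := leP (f X1) (f X).
  exists X1; first exact: mem_head.
  by move=> X'; rewrite in_cons => /orP[/eqP -> //|/Xmin]; exact: le_trans.
exists X; first by rewrite in_cons Xs orbT.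
by move=> X'; rewrite in_cons => /orP[/eqP -> |/Xmin//]; exact: ltW.
Qed.

(** Since [K] is nonnegative, an element whose penalty exceeds r, where a r is the objective at
    [X0], cannot do better than [X0]. By Kraft only finitely many elements remain. *)
Lemma penalized_argmin (R : realType) (U : choiceType) (D : set U)
    (pen : U -> R) (K : U -> \bar R) (a : R) X0 :
  (\esum_(X in D) (2 `^ (- pen X))%:E <= 1)%E -> 0 < a ->
  (forall X, D X -> 0 <= K X)%E -> D X0 -> (K X0 < +oo)%E ->
  exists X, is_argmin D (fun X => K X + (a * pen X)%:E)%E X.
Proof.
move=> kraft a0 K0 DX0 KX0.
pose f X := (K X + (a * pen X)%:E)%E.
have K0fin : K X0 \is a fin_num by rewrite ge0_fin_numE// K0.
pose r := (fine (K X0) + a * pen X0) / a.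
have fX0 : f X0 = (a * r)%:E.
  rewrite /f -(fineK K0fin) -EFinD /r; congr EFin; field; exact: lt0r_neq0.
have [s sE] := (finite_seqP _).1 (finite_set_kraft r kraft).
have insE X : (X \in s) = `[< D X /\ pen X <= r >].
  apply/idP/asboolP => [|H]; first by move=> Xs; have : [set` s] X by []; rewrite -sE.
  by have : [set` s] X by rewrite -sE.
have X0s : X0 \in s.
  rewrite insE; apply/asboolP; split => //.
  by rewrite -(ler_pM2l a0) -lee_fin -fX0 /f leeDr// K0.
have [X Xs Xmin] := seq_argmin f X0s; exists X.
move: (Xs); rewrite insE => /asboolP[DX _]; split=> // X' DX'.
have [X'r|X'r] := leP (pen X') r.
  by apply: Xmin; rewrite insE; apply/asboolP.
apply: (le_trans (Xmin _ X0s)); rewrite fX0.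
apply: (@le_trans _ _ (a * pen X')%:E); first by rewrite lee_fin ler_pM2l// ltW.
by rewrite leeDr// K0.
Qed.

(** * The exponential moment and the risk of the penalized estimator *)

Section penalized_likelihood.
Context {R : realType} {n1 n2 : nat} d (T : measurableType d).
Variables (P : probability T R) (mu : {measure set (measurableTypeR R) -> \bar R}).
Variables (p : R -> R -> R) (Xstar : 'M[R]_(n1, n2)).
Variables (calX : set 'M[R]_(n1, n2)) (pen : 'M[R]_(n1, n2) -> R).
Variables (S : T -> {set 'I_n1 * 'I_n2}) (Y : T -> 'M[R]_(n1, n2)).
Variables (gamma CD xi : R).
Variable Xhat : {set 'I_n1 * 'I_n2} -> 'M[R]_(n1, n2) -> 'M[R]_(n1, n2).
Hypothesis p_density : forall x, is_density mu (p x).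
Hypothesis calX_countable : countable calX.
Hypothesis pen_ge0 : forall X, calX X -> 0 <= pen X.
Hypothesis kraft : (\esum_(X in calX) (2 `^ (- pen X))%:E <= 1)%E.
Hypothesis gamma01 : 0 < gamma <= 1.
Hypothesis S_law : bernoulli_sampling P gamma S.
Hypothesis Y_law : observation_law P mu p Xstar S Y.
Hypothesis CD_ge0 : 0 <= CD.
Hypothesis CD_ge : forall X, calX X -> forall i j,
  (KL mu (p (Xstar i j)) (p (X i j)) <= CD%:E)%E.
Hypothesis xi_ge : (1 + 2 * CD / 3) * (2 * ln 2) <= xi.
Hypothesis Xhat_mle : is_penalized_mle P p calX pen xi S Y Xhat.

Local Notation I := ('I_n1 * 'I_n2)%type.
Local Notation pstar ij := (p (Xstar ij.1 ij.2)).
Local Notation estimate w := (Xhat (S w) (observed (S w) (Y w))).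

Let aff (Z : 'M[R]_(n1, n2)) (ij : I) : R :=
  fine (affinity mu (p (Z ij.1 ij.2)) (pstar ij)).
Let a Z ij : R := - 2 * ln (aff Z ij).

Definition hellinger_loss (Z : 'M[R]_(n1, n2)) : R := \sum_ij a Z ij.

Let affP Z ij : calX Z ->
  [/\ affinity mu (p (Z ij.1 ij.2)) (pstar ij) = (aff Z ij)%:E,
      0 < aff Z ij <= 1, 0 <= a Z ij <= CD &
      ((a Z ij)%:E <= KL mu (pstar ij) (p (Z ij.1 ij.2)))%E].
Proof.
move=> DZ; have [A [AE A01 AKL AC]] :=
  affinity_KL (p_density _) (p_density _) (CD_ge DZ ij.1 ij.2).
have affE : aff Z ij = A by rewrite /aff AE.
rewrite /a affE; split => //; rewrite AC andbT.
by have /andP[_ /ln_le0] := A01; lra.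
Qed.

Lemma lne_affinity_mx Z : calX Z ->
  (- 2%:E * lne (affinity_mx mu p Z Xstar) = (hellinger_loss Z)%:E)%E.
Proof.
move=> DZ; rewrite /affinity_mx pair_big/=.
rewrite (eq_bigr (fun ij => (aff Z ij)%:E)); last first.
  by move=> ij _; have [] := affP ij DZ.
have aff_pos ij : 0 < aff Z ij by have [_ /andP[]] := affP ij DZ.
rewrite prodEFin lne_EFin; last exact: prodr_gt0.
transitivity ((- 2 * ln (\prod_ij aff Z ij))%:E : \bar R); first by [].
rewrite /hellinger_loss /a -mulr_sumr; do 2! apply: congr1.
rewrite -[RHS]expRK expR_sum; apply: congr1.
by apply: eq_bigr => ij _; rewrite lnK ?posrE.
Qed.

Lemma hellinger_loss_ge0 Z : calX Z -> 0 <= hellinger_loss Z.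
Proof. by move=> DZ; apply: sumr_ge0 => ij _; have [_ _ /andP[]] := affP ij DZ. Qed.

Lemma KL_fineE Z ij : calX Z ->
  (KL mu (pstar ij) (p (Z ij.1 ij.2)) =
   (fine (KL mu (pstar ij) (p (Z ij.1 ij.2))))%:E)%E.
Proof.
move=> DZ; have [_ _ /andP[a0 _] aKL] := affP ij DZ.
rewrite fineK// ge0_fin_numE.
  by apply: (le_lt_trans (CD_ge DZ _ _)); exact: ltry.
by apply: le_trans aKL; rewrite lee_fin.
Qed.

Lemma KL_fine_ge0 Z ij : calX Z ->
  0 <= fine (KL mu (pstar ij) (p (Z ij.1 ij.2))).
Proof.
move=> DZ; have [_ _ /andP[a0 _] aKL] := affP ij DZ.
by apply: fine_ge0; apply: le_trans aKL; rewrite lee_fin.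
Qed.

(* The power t of the likelihood ratio: small enough for exp(-t a) to be at
   most 1 - t a / 2 whenever a <= CD, and large enough for t xi >= ln 2. *)
Let t : R := (2 * (1 + 2 * CD / 3))^-1.

Let t_gt0 : 0 < t.
Proof. by rewrite invr_gt0; have := CD_ge0; lra. Qed.

Let t_le : t <= 2^-1.
Proof. by rewrite lef_pV2 ?posrE//; have := CD_ge0; lra. Qed.

Let tCD : t * CD <= 1.
Proof.
have h : 0 < 2 * (1 + 2 * CD / 3) by have := CD_ge0; lra.
by rewrite /t mulrC ler_pdivrMr//; have := CD_ge0; lra.
Qed.

Let t_xi : ln 2 <= t * xi.
Proof.
have h : 0 < 2 * (1 + 2 * CD / 3) by have := CD_ge0; lra.
by rewrite /t mulrC ler_pdivlMr//; have := xi_ge; lra.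
Qed.

Let rho (Z : 'M[R]_(n1, n2)) ij (y : R) : R := (p (Z ij.1 ij.2) y / pstar ij y) `^ t.

(** The exponential factor offsets the decay of the expected product of ratios, so that the mean is
    at most 2^(-pen Z). *)
Let weight Z w : R := 2 `^ (- pen Z) * expR (gamma * t / 2 * hellinger_loss Z) *
  \prod_(ij in S w) rho Z ij (Y w ij.1 ij.2).

Let mp x : measurable_fun [set: measurableTypeR R] (p x : measurableTypeR R -> R).
Proof. by case: (p_density x). Qed.

Let mratio Z ij : measurable_fun [set: measurableTypeR R]
  (fun y : measurableTypeR R => p (Z ij.1 ij.2) y / pstar ij y).
Proof.
apply: measurable_funM => //.
under eq_fun => y do [have [_ p0 _] := p_density (Xstar ij.1 ij.2);
  rewrite -powR_inv1//].
exact: (measurableT_comp (measurable_powR _) (mp _)).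
Qed.

Let mrho Z ij :
  measurable_fun [set: measurableTypeR R] (rho Z ij : measurableTypeR R -> R).
Proof. exact: (measurableT_comp (measurable_powR t) (mratio Z ij)). Qed.

Let rho_ge0 Z ij y : 0 <= rho Z ij y. Proof. exact: powR_ge0. Qed.

Let weight_ge0 Z w : 0 <= weight Z w.
Proof. by rewrite !mulr_ge0 ?powR_ge0 ?expR_ge0// prodr_ge0. Qed.

Let mweight Z : measurable_fun [set: T] (weight Z).
Proof.
apply: measurable_funM; first exact: measurable_cst.
exact: (measurable_prod_sampled S_law Y_law (mrho Z)).
Qed.

(** By [likelihood_ratio_moment] each entry contributes 1 - gamma + gamma c <= 1 - gamma t a / 2 <=
    exp (- gamma t a / 2). The product of these cancels the exponential factor of the weight. *)
Let expectation_weight Z : calX Z ->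
  (\int[P]_w (weight Z w)%:E <= (2 `^ (- pen Z))%:E)%E.
Proof.
move=> DZ.
have /choice[c Hc] : forall ij, exists c,
    (\int[mu]_y (pstar ij y * rho Z ij y)%:E = c%:E)%E /\ c <= 1 - t * a Z ij / 2.
  move=> ij; have [affE aff01 /andP[a0 aCD] _] := affP ij DZ.
  have [||c ce cle] :=
    likelihood_ratio_moment (p_density _) (p_density _) affE aff01 (t := t).
  - by rewrite t_gt0.
  - by apply: le_trans tCD; rewrite ler_wpM2l// ltW.
  by exists c.
have c0 ij : 0 <= c ij.
  rewrite -lee_fin -(Hc ij).1; apply: integral_ge0 => y _.
  by have [_ p0 _] := p_density (Xstar ij.1 ij.2); rewrite lee_fin mulr_ge0.
have /andP[g0 g1] := gamma01.
have -> : (\int[P]_w (weight Z w)%:E =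
    (2 `^ (- pen Z) * expR (gamma * t / 2 * hellinger_loss Z))%:E *
    \int[P]_w (\prod_(ij in S w) rho Z ij (Y w ij.1 ij.2))%:E)%E.
  rewrite -ge0_integralZl//.
  - apply/measurable_EFinP.
    exact: (measurable_prod_sampled S_law Y_law (mrho Z)).
  - by move=> w _; rewrite lee_fin prodr_ge0.
rewrite (expectation_prod_sampled p_density S_law Y_law (mrho Z) (rho_ge0 Z)
  (fun ij => (Hc ij).1)) -EFinM lee_fin.
rewrite -[leRHS]mulr1 -[leLHS]mulrA ler_wpM2l ?powR_ge0//.
apply: (@le_trans _ _ (expR (gamma * t / 2 * hellinger_loss Z) *
  expR (- (gamma * t / 2 * hellinger_loss Z)))); last first.
  by rewrite -expRD subrr expR0.
rewrite ler_wpM2l ?expR_ge0// /hellinger_loss mulr_sumr -sumrN expR_sum.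
apply: ler_prod => ij _; apply/andP; split.
  by have := c0 ij; nra.
apply: le_trans (expR_ge1Dx _).
by have := (Hc ij).2; nra.
Qed.

(** [V] is the sum of all weights, of mean at most 1 by Kraft. As it dominates every weight
    pointwise, it also dominates the weight at the data-dependent estimate, to which
    [expectation_weight] does not apply. *)
Let dominating_weight : exists V : T -> \bar R,
  [/\ measurable_fun [set: T] V, forall w, (0 <= V w)%E,
      forall Z w, calX Z -> ((weight Z w)%:E <= V w)%E &
      (\int[P]_w V w <= 1)%E].
Proof.
have [g [gD Dg gsum]] := countable_enumeration calX_countable.
pose u n w := oapp (fun Z => (weight Z w)%:E) 0%E (g n).
have u0 n w : (0 <= u n w)%E by rewrite /u; case: (g n) => //= Z; rewrite lee_fin.
have mu_ n : measurable_fun [set: T] (u n).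
  by rewrite /u; case: (g n) => [Z|] /=; [exact/measurable_EFinP|exact: measurable_cst].
exists (fun w => \sum_(n <oo) u n w)%E; split.
- by apply: ge0_emeasurable_sum.
- by move=> w; apply: nneseries_ge0.
- move=> Z w DZ; have [n gn] := Dg _ DZ.
  have -> : (weight Z w)%:E = u n w by rewrite /u gn.
  rewrite (nneseriesD1 (n := n))// leeDl//; exact: nneseries_ge0.
rewrite integral_nneseries//.
apply: (@le_trans _ _ (\sum_(n <oo) oapp (fun Z => (2 `^ (- pen Z))%:E) 0%E (g n))%E).
  apply: lee_nneseries => [n _ _|n _]; first exact: integral_ge0.
  rewrite /u; case E : (g n) => [Z|] /=; last by rewrite integral0.
  by apply: expectation_weight; exact: gD E.
rewrite gsum// => Z _; rewrite lee_fin; exact: powR_ge0.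
Qed.

Let prod_exp_ln (s : {set I}) (x : I -> R) :
  (forall ij, ij \in s -> 0 < x ij) ->
  \prod_(ij in s) x ij = expR (\sum_(ij in s) ln (x ij)).
Proof.
by move=> x0; rewrite expR_sum; apply: eq_bigr => ij /x0 xp; rewrite lnK ?posrE.
Qed.

(** This is 1 + x <= exp x at the logarithm of the weight, combined with minimality of [Z]. The
    log-ratio of [pstar] to [p_X] is split into its negative part on the left and its positive part
    on the right, so that every term to be integrated is nonnegative. *)
Let pathwise_bound X Z (s : {set I}) (y : 'M[R]_(n1, n2)) (w : T) :
  calX X -> calX Z -> S w = s -> Y w = y ->
  (forall ij, ij \in s -> pstar ij (y ij.1 ij.2) != 0) ->
  (forall ij, ij \in s -> p (X ij.1 ij.2) (y ij.1 ij.2) != 0) ->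
  is_argmin calX (penalized_nll p pen xi s (observed s y)) Z ->
  gamma * t / 2 * hellinger_loss Z + 1 + t * (\sum_(ij in s)
      Num.max (- ln (pstar ij (y ij.1 ij.2) / p (X ij.1 ij.2) (y ij.1 ij.2))) 0)
  <= weight Z w + t * xi * pen X + t * (\sum_(ij in s)
      Num.max (ln (pstar ij (y ij.1 ij.2) / p (X ij.1 ij.2) (y ij.1 ij.2))) 0).
Proof.
move=> DX DZ Sw Yw star0 X0 [_ /(_ _ DX)].
have p_pos x v : p x v != 0 -> 0 < p x v.
  by move=> pn0; rewrite lt_def pn0; have [_ ->] := p_density x.
have likE U : likelihood p U s (observed s y) =
    \prod_(ij in s) p (U ij.1 ij.2) (y ij.1 ij.2).
  by apply: eq_bigr => -[i j] ijs; rewrite mxE ijs.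
have likX := prod_exp_ln (fun ij ijs => p_pos _ _ (X0 ij ijs)).
rewrite /penalized_nll !likE likX (lne_EFin (expR_gt0 _)) expRK -EFinN -EFinD.
(* A zero likelihood would give [Z] an infinite objective, whereas that of [X] is finite. *)
have [lZ0|lZ0] := eqVneq (\prod_(ij in s) p (Z ij.1 ij.2) (y ij.1 ij.2)) 0.
  by rewrite lZ0 le0_lneNy// /= addye.
have Z0 ij : ij \in s -> 0 < p (Z ij.1 ij.2) (y ij.1 ij.2).
  move=> ijs; apply: p_pos; apply: contra_neq lZ0 => pZ0.
  by rewrite (bigD1 ij)//= pZ0 mul0r.
rewrite (prod_exp_ln Z0) (lne_EFin (expR_gt0 _)) expRK -EFinN -EFinD lee_fin.
set lZ := \sum_(ij in s) ln _; set lX := \sum_(ij in s) ln _ => ZX.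
pose ls := \sum_(ij in s) ln (pstar ij (y ij.1 ij.2)).
have weightE : weight Z w = expR (- pen Z * ln 2 +
    gamma * t / 2 * hellinger_loss Z + t * (lZ - ls)).
  rewrite /weight Sw Yw !expRD; congr (_ * _ * _).
    by rewrite /powR pnatr_eq0.
  rewrite /lZ /ls -sumrB mulr_sumr expR_sum; apply: eq_bigr => ij ijs.
  have ps := p_pos _ _ (star0 _ ijs).
  rewrite /rho /powR gt_eqF ?divr_gt0 ?Z0//.
  by rewrite ln_div ?posrE ?Z0//.
have lE : \sum_(ij in s)
      Num.max (ln (pstar ij (y ij.1 ij.2) / p (X ij.1 ij.2) (y ij.1 ij.2))) 0 =
    \sum_(ij in s)
      Num.max (- ln (pstar ij (y ij.1 ij.2) / p (X ij.1 ij.2) (y ij.1 ij.2))) 0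
    + (ls - lX).
  rewrite /lX /ls -sumrB -big_split; apply: eq_bigr => ij ijs /=.
  rewrite ln_div ?posrE; [|exact: p_pos (star0 _ ijs)|exact: p_pos (X0 _ ijs)].
  set x := _ - _; have [x0|x0] := leP 0 x.
    by rewrite (max_r (_ : - x <= 0)) ?add0r// oppr_le0.
  by rewrite max_l ?addNr// oppr_ge0 ltW.
rewrite lE weightE.
have := expR_ge1Dx (- pen Z * ln 2 + gamma * t / 2 * hellinger_loss Z + t * (lZ - ls)).
(* Minimality trades [lZ] for [lX], and [t * xi >= ln 2] lets the penalty of [Z] absorb the factor
   2^(-pen Z). *)
have tZX : t * (- lZ + xi * pen Z) <= t * (- lX + xi * pen X).
  by rewrite ler_wpM2l// ltW.
have penZ : ln 2 * pen Z <= t * xi * pen Z.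
  by rewrite ler_wpM2r// pen_ge0.
lra.
Qed.

(** The pathwise bound is integrated: the mean of [V] cancels the constant 1, the two parts of the
    log-ratio recombine into at most [gamma] times the divergence, and division by [gamma * t / 2]
    produces the factor 2. *)
Lemma expected_hellinger_loss_le X : calX X ->
  (\int[P]_w (hellinger_loss (estimate w))%:E <=
   (2 * (\sum_ij fine (KL mu (pstar ij) (p (X ij.1 ij.2))) +
         xi * pen X / gamma))%:E)%E.
Proof.
move=> DX; have [Dhat mhat argmin_hat] := Xhat_mle.
have /andP[g0 g1] := gamma01.
have [V [mV V0 wV intV]] := dominating_weight.
have /choice[K HK] : forall ij, exists K : R * R,
  [/\ (\int[mu]_y (pstar ij y * Num.max
        (ln (pstar ij y / p (X ij.1 ij.2) y)) 0)%:E = K.1%:E)%E,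
      (\int[mu]_y (pstar ij y * Num.max
        (- ln (pstar ij y / p (X ij.1 ij.2) y)) 0)%:E = K.2%:E)%E
    & K.1 - K.2 <= fine (KL mu (pstar ij) (p (X ij.1 ij.2)))].
  move=> ij; have [Kp [Kn [hp hn hK]]] :=
    KL_posneg (p_density _) (p_density _) (CD_ge DX ij.1 ij.2).
  by exists (Kp, Kn); split => //=; rewrite -lee_fin -KL_fineE.
pose lp ij (y : measurableTypeR R) := Num.max (ln (pstar ij y / p (X ij.1 ij.2) y)) 0.
pose ln_ ij (y : measurableTypeR R) :=
  Num.max (- ln (pstar ij y / p (X ij.1 ij.2) y)) 0.
have mln ij : measurable_fun [set: measurableTypeR R]
    (fun y : measurableTypeR R => ln (pstar ij y / p (X ij.1 ij.2) y)).
  apply: (measurableT_comp (@measurable_ln R)); apply: measurable_funM => //.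
  under eq_fun => y do [have [_ p0 _] := p_density (X ij.1 ij.2);
    rewrite -powR_inv1//].
  exact: (measurableT_comp (measurable_powR _) (mp _)).
have mlp ij : measurable_fun [set: measurableTypeR R] (lp ij).
  by apply: measurable_maxr => //; exact: measurable_cst.
have mlnn ij : measurable_fun [set: measurableTypeR R] (ln_ ij).
  apply: measurable_maxr; last exact: measurable_cst.
  exact: measurableT_comp.
have lp0 ij y : 0 <= lp ij y by rewrite le_max lexx orbT.
have ln0 ij y : 0 <= ln_ ij y by rewrite le_max lexx orbT.
have Kp ij : (\int[mu]_y (pstar ij y * lp ij y)%:E = (K ij).1%:E)%E by have [] := HK ij.
have Kn ij : (\int[mu]_y (pstar ij y * ln_ ij y)%:E = (K ij).2%:E)%E by have [] := HK ij.
have intp := expectation_sum_sampled p_density S_law Y_law mlp lp0 Kp.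
have intn := expectation_sum_sampled p_density S_law Y_law mlnn ln0 Kn.
have zero_set (Z : 'M[R]_(n1, n2)) ij :
    measurable [set y : measurableTypeR R | p (Z ij.1 ij.2) y = 0].
  rewrite (_ : [set _ | _] = p (Z ij.1 ij.2) @^-1` [set 0])//.
  by rewrite -[X in measurable X]setTI; exact: mp.
(* Almost surely neither density vanishes at a sampled entry: [pstar] because the observation
   follows it, [p_X] by [KL_abs_cont]. *)
have ae_star := ae_sampled_entry p_density S_law Y_law
  (B := fun ij => [set y | pstar ij y = 0]) (zero_set Xstar).
have ae_X := ae_sampled_entry p_density S_law Y_law
  (B := fun ij => [set y | p (X ij.1 ij.2) y = 0]) (zero_set X).
have {}ae_star : {ae P, forall w ij, ij \in S w ->
    ~ pstar ij (Y w ij.1 ij.2) = 0}.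
  apply: ae_star => ij; apply: integral0_eq => y _.
  rewrite indicE; have [yz|yz] := boolP (y \in _); last by rewrite mulr0.
  by move: yz; rewrite inE/= => ->; rewrite mul0r.
have {}ae_X : {ae P, forall w ij, ij \in S w ->
    ~ p (X ij.1 ij.2) (Y w ij.1 ij.2) = 0}.
  apply: ae_X => ij.
  exact: (KL_abs_cont (p_density _) (p_density _) (CD_ge DX ij.1 ij.2)).
have mloss : measurable_fun [set: T] (fun w => hellinger_loss (estimate w)).
  exact: (measurable_fun_countable_range hellinger_loss calX_countable Dhat mhat).
have msp := measurable_sum_sampled S_law Y_law mlp.
have msn := measurable_sum_sampled S_law Y_law mlnn.
have loss0 w : 0 <= hellinger_loss (estimate w) by exact: hellinger_loss_ge0.
have sp0 w : 0 <= \sum_(ij in S w) lp ij (Y w ij.1 ij.2) by exact: sumr_ge0.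
have sn0 w : 0 <= \sum_(ij in S w) ln_ ij (Y w ij.1 ij.2) by exact: sumr_ge0.
have t0 : 0 <= t by exact: ltW.
have xi0 : 0 <= xi.
  by rewrite -(pmulr_rge0 _ t_gt0); apply: le_trans t_xi; exact/ln_ge0/ler1n.
have gt0 : 0 <= gamma * t / 2 by rewrite divr_ge0// mulr_ge0// ltW.
have cst_int (r : R) : (\int[P]_w r%:E = r%:E)%E.
  rewrite integral_cst//; transitivity (r%:E * 1)%E; last by rewrite mule1.
  by congr (_ * _)%E; exact: probability_setT.
have mE (f : T -> R) : measurable_fun [set: T] f ->
  measurable_fun [set: T] (fun w => (f w)%:E) by move=> mf; exact/measurable_EFinP.
have intL : (\int[P]_w ((gamma * t / 2)%:E * (hellinger_loss (estimate w))%:E +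
      (1%:E + t%:E * (\sum_(ij in S w) ln_ ij (Y w ij.1 ij.2))%:E)) =
    (gamma * t / 2)%:E * \int[P]_w (hellinger_loss (estimate w))%:E +
    (1 + t * (gamma * \sum_ij (K ij).2))%:E)%E.
  rewrite ge0_integralD//; last 4 first.
  - by move=> w _; rewrite mule_ge0// lee_fin.
  - by apply: measurable_funeM; exact: mE.
  - by move=> w _; rewrite adde_ge0// mule_ge0// lee_fin.
  - apply: emeasurable_funD; first exact: measurable_cst.
    by apply: measurable_funeM; exact: mE.
  congr (_ + _)%E.
    apply: ge0_integralZl => //; first exact: mE.
    by move=> w _; rewrite lee_fin.
  rewrite ge0_integralD//; last 2 first.
  - by move=> w _; rewrite mule_ge0// lee_fin.
  - by apply: measurable_funeM; exact: mE.
  rewrite cst_int EFinD; congr (_ + _)%E.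
  rewrite EFinM -intn; apply: ge0_integralZl => //; first exact: mE.
  by move=> w _; rewrite lee_fin.
have intR : (\int[P]_w (V w + ((t * xi * pen X)%:E +
      t%:E * (\sum_(ij in S w) lp ij (Y w ij.1 ij.2))%:E)) =
    \int[P]_w V w + (t * xi * pen X + t * (gamma * \sum_ij (K ij).1))%:E)%E.
  have c0 : 0 <= t * xi * pen X by rewrite !mulr_ge0// pen_ge0.
  rewrite ge0_integralD//; last 2 first.
  - by move=> w _; rewrite adde_ge0// mule_ge0// lee_fin.
  - apply: emeasurable_funD; first exact: measurable_cst.
    by apply: measurable_funeM; exact: mE.
  congr (_ + _)%E.
  rewrite ge0_integralD//; last 2 first.
  - by move=> w _; rewrite mule_ge0// lee_fin.
  - by apply: measurable_funeM; exact: mE.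
  rewrite cst_int EFinD; congr (_ + _)%E.
  rewrite EFinM -intp; apply: ge0_integralZl => //; first exact: mE.
  by move=> w _; rewrite lee_fin.
have : ((gamma * t / 2)%:E * \int[P]_w (hellinger_loss (estimate w))%:E +
    (1 + t * (gamma * \sum_ij (K ij).2))%:E <=
    1 + (t * xi * pen X + t * (gamma * \sum_ij (K ij).1))%:E)%E.
  apply: (@le_trans _ _ (\int[P]_w V w +
    (t * xi * pen X + t * (gamma * \sum_ij (K ij).1))%:E)%E); last by rewrite leeD2r.
  rewrite -intL -intR; apply: ae_ge0_le_integral => //.
  - by move=> w _; rewrite adde_ge0// ?adde_ge0// ?mule_ge0// lee_fin.
  - apply: emeasurable_funD; first by apply: measurable_funeM; exact: mE.
    apply: emeasurable_funD; first exact: measurable_cst.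
    by apply: measurable_funeM; exact: mE.
  - move=> w _; rewrite adde_ge0// adde_ge0// ?mule_ge0// lee_fin//.
    by rewrite !mulr_ge0// pen_ge0.
  - apply: emeasurable_funD => //; apply: emeasurable_funD; first exact: measurable_cst.
    by apply: measurable_funeM; exact: mE.
  apply: filterS3 ae_star ae_X argmin_hat => w star_w X_w arg_w _.
  have := pathwise_bound DX (Dhat w) erefl erefl
    (fun ij ijS => introN eqP (star_w ij ijS))
    (fun ij ijS => introN eqP (X_w ij ijS)) arg_w.
  move=> bnd; apply: (@le_trans _ _ ((weight (estimate w) w)%:E + ((t * xi * pen X)%:E +
      t%:E * (\sum_(ij in S w) lp ij (Y w ij.1 ij.2))%:E))%E); last first.
    by rewrite leeD2r// wV.
  by rewrite -!EFinM -!EFinD lee_fin !addrA.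
have J0 : (0 <= \int[P]_w (hellinger_loss (estimate w))%:E)%E.
  by apply: integral_ge0 => w _; rewrite lee_fin.
have gpos : 0 < gamma * t / 2 by rewrite divr_gt0// mulr_gt0.
(* An infinite expected loss would contradict the finite right side; the rest is real arithmetic. *)
case: (\int[P]_w _)%E J0 => [J| |]// J0; last first.
  by rewrite gt0_muley ?lte_fin// addye.
rewrite -EFinM -!EFinD !lee_fin => H.
have sK : \sum_ij (K ij).1 - \sum_ij (K ij).2 <=
    \sum_ij fine (KL mu (pstar ij) (p (X ij.1 ij.2))).
  by rewrite -sumrB; apply: ler_sum => ij _; have [] := HK ij.
have tg : 0 < t * gamma by rewrite mulr_gt0.
rewrite -(ler_pM2l tg) [leRHS](_ : _ = 2 * (t * gamma * \sum_ij
  fine (KL mu (pstar ij) (p (X ij.1 ij.2))) + t * xi * pen X)); last first.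
  by field; rewrite gt_eqF.
have := ler_wpM2l (ltW tg) sK.
lra.
Qed.

End penalized_likelihood.

(** * The final risk bound *)

Lemma EFin_div (R : realType) (x r : R) : 0 < r ->
  (x%:E / r%:E = (x / r)%:E)%E.
Proof. by move=> r0; rewrite inver gt_eqF. Qed.

Theorem lemmaA1 (R : realType)
    (mu : {measure set (measurableTypeR R) -> \bar R}) (p : R -> R -> R)
    (n1 n2 m : nat) (Xstar : 'M[R]_(n1, n2))
    (calX : set 'M[R]_(n1, n2)) (pen : 'M[R]_(n1, n2) -> R)
    (d : measure_display) (T : measurableType d) (P : probability T R)
    (S : T -> {set 'I_n1 * 'I_n2}) (Y : T -> 'M[R]_(n1, n2)) (CD xi : R)
    (Xhat : {set 'I_n1 * 'I_n2} -> 'M[R]_(n1, n2) -> 'M[R]_(n1, n2))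
    (p_density : forall x, is_density mu (p x))
    (calX_countable : countable calX)
    (pen_ge1 : forall X, calX X -> 1 <= pen X)
    (kraft : (\esum_(X in calX) (2 `^ (- pen X))%:E <= 1)%E)
    (m_bounds : (4 <= m <= n1 * n2)%N)
    (S_law : bernoulli_sampling P (m%:R / (n1 * n2)%:R) S)
    (Y_law : observation_law P mu p Xstar S Y)
    (CD_ge : forall X, calX X -> forall i j,
       (KL mu (p (Xstar i j)) (p (X i j)) <= CD%:E)%E)
    (xi_ge : (1 + 2 * CD / 3) * (2 * ln 2) <= xi)
    (Xhat_mle : is_penalized_mle P p calX pen xi S Y Xhat) :
  let bound X :=
    (KL_mx mu p Xstar X / (n1 * n2)%:R%:E
     + ((xi + 4 * CD * ln 2 / 3) * (pen X / m%:R))%:E)%E in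
  exists2 Xmin, is_argmin calX bound Xmin &
  ((\int[P]_w (- 2%:E *
      lne (affinity_mx mu p (Xhat (S w) (observed (S w) (Y w))) Xstar)))
     / (n1 * n2)%:R%:E
   <= 3%:E * bound Xmin + (8 * CD * ln m%:R / m%:R)%:E)%E.
Proof.
have m_gt0 : (0 < m)%N by case/andP: m_bounds => m4 _; exact: leq_trans m4.
have N_gt0 : (0 < n1 * n2)%N.
  by case/andP: m_bounds => _; exact: leq_trans.
have mR : 0 < m%:R :> R by rewrite ltr0n.
have NR : 0 < (n1 * n2)%:R :> R by rewrite ltr0n.
have gamma01 : 0 < (m%:R / (n1 * n2)%:R : R) <= 1.
  rewrite divr_gt0//= ler_pdivrMr// mul1r ler_nat.
  by case/andP: m_bounds.
have pen_ge0 X : calX X -> 0 <= pen X.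
  by move=> /pen_ge1; apply: le_trans.
(* A probability space is nonempty, and the estimate at any of its points supplies an element of
   [calX]. *)
have [w0] : [set: T] !=set0.
  apply/set0P/eqP => T0; have := probability_setT P.
  by rewrite T0 measure0 => /esym/eqP; rewrite onee_eq0.
have [Dhat _ _] := Xhat_mle; move=> _.
have DX0 := Dhat w0; set X0 := Xhat _ _ in DX0.
(* The matrix has an entry since m >= 4, and there 0 <= -2 ln A <= CD. *)
have CD_ge0 : 0 <= CD.
  move: N_gt0; rewrite muln_gt0 => /andP[n1_gt0 n2_gt0].
  have [A [_ /andP[_ /ln_le0 lnA] _ AC]] := affinity_KL (p_density _)
    (p_density _) (CD_ge _ DX0 (Ordinal n1_gt0) (Ordinal n2_gt0)).
  by apply: le_trans AC; lra.
have ln2 : 0 < ln 2 :> R by rewrite ln_gt0// ltr1n.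
have xi_gt0 : 0 < xi.
  apply: lt_le_trans xi_ge; rewrite !mulr_gt0//; lra.
have KL_mxE X : calX X -> KL_mx mu p Xstar X =
    (\sum_ij fine (KL mu (p (Xstar ij.1 ij.2)) (p (X ij.1 ij.2))))%:E.
  move=> DX; rewrite /KL_mx pair_big -sumEFin; apply: eq_bigr => ij _.
  exact: (KL_fineE p_density CD_ge).
have divN x := EFin_div x NR.
pose c := xi + 4 * CD * ln 2 / 3.
have c_gt0 : 0 < c.
  by rewrite ltr_wpDr// divr_ge0// mulr_ge0 ?mulr_ge0// ltW.
have KLmx_ge0 X : calX X ->
    0 <= \sum_ij fine (KL mu (p (Xstar ij.1 ij.2)) (p (X ij.1 ij.2))).
  by move=> DX; apply: sumr_ge0 => ij _; exact: (KL_fine_ge0 p_density CD_ge).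
move=> bound.
have boundE : bound = fun X =>
    (KL_mx mu p Xstar X / (n1 * n2)%:R%:E + (c / m%:R * pen X)%:E)%E.
  apply/funext => X; rewrite /bound -/c.
  by rewrite (_ : c * (pen X / m%:R) = c / m%:R * pen X)// mulrA mulrAC.
have [Xmin Xmin_argmin] : exists X, is_argmin calX bound X.
  rewrite boundE; apply: (penalized_argmin (X0 := X0)) => //.
  - by rewrite divr_gt0.
  - by move=> X DX; rewrite KL_mxE// divN lee_fin divr_ge0// ?KLmx_ge0// ltW.
  - by rewrite KL_mxE// divN ltry.
exists Xmin => //; have [DX _] := Xmin_argmin.
rewrite (eq_integral (fun w =>
  (hellinger_loss mu p Xstar (Xhat (S w) (observed (S w) (Y w))))%:E)); last first.
  by move=> w _; rewrite (lne_affinity_mx p_density CD_ge).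
have := expected_hellinger_loss_le p_density calX_countable pen_ge0 kraft gamma01
  S_law Y_law CD_ge0 CD_ge xi_ge Xhat_mle DX.
have : (0 <= \int[P]_w (hellinger_loss mu p Xstar
    (Xhat (S w) (observed (S w) (Y w))))%:E)%E.
  apply: integral_ge0 => w _; rewrite lee_fin.
  exact: (hellinger_loss_ge0 p_density CD_ge).
case: (\int[P]_w _)%E => [J| |]// _; rewrite lee_fin divN boundE KL_mxE// divN.
set K := \sum_ij _ => JK.
suff : J / (n1 * n2)%:R <= 3 * (K / (n1 * n2)%:R + c / m%:R * pen Xmin) +
    8 * CD * ln m%:R / m%:R by rewrite -lee_fin.
have K0 : 0 <= K by exact: KLmx_ge0.
have pen0 := pen_ge0 _ DX.
have lnm : 0 <= ln m%:R :> R by rewrite ln_ge0// ler1n.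
(* The bound is obtained with constants 2 and [xi]; passing to 3 and [c] and adding the residual
   term only enlarges the right side, as all terms are nonnegative. *)
apply: (@le_trans _ _ (2 * (K / (n1 * n2)%:R + xi / m%:R * pen Xmin))).
  rewrite ler_pdivrMr//; apply: (le_trans JK); rewrite le_eqVlt; apply/orP; left.
  have rescale (M N : R) : M != 0 -> N != 0 ->
      2 * (K + xi * pen Xmin / (M / N)) = 2 * (K / N + xi / M * pen Xmin) * N.
    by move=> M0 N0; field; rewrite M0.
  by apply/eqP; apply: rescale; rewrite gt_eqF.
have h1 : 0 <= K / (n1 * n2)%:R by rewrite divr_ge0// ltW.
have h2 : 0 <= xi / m%:R * pen Xmin by rewrite mulr_ge0// divr_ge0// ltW.
have h3 : xi / m%:R * pen Xmin <= c / m%:R * pen Xmin.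
  rewrite ler_wpM2r// ler_pM2r ?invr_gt0// /c lerDl.
  by rewrite divr_ge0// mulr_ge0 ?mulr_ge0// ltW.
have h4 : 0 <= 8 * CD * ln m%:R / m%:R.
  by rewrite divr_ge0 ?(ltW mR)// mulr_ge0// mulr_ge0.
lra.
Qed.
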